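(* Let $p$ be a prime and $K$ an algebraically closed field of characteristic $p$. An element $x=\sum_i x_it^i\in K((t^{\mathbb{Q}}))$ is integral over $K((t))$ if and only if the series \[ y_n=\sum_{i\in[0,1)\cap\mathbb{Q}} x_{n+i}t^i \qquad (n\in\mathbb{Z}) \] are all $p$-quasi-automatic and span a finite-dimensional $K$-vector subspace of $K((t^{\mathbb{Q}}))$.
   Context: $\varphi: K\to K$ denotes the Frobenius $x\mapsto x^p$, an automorphism of $K$. $K((t^{\mathbb{Q}}))$ is the field of generalized (Hahn) power series $x=\sum_{i\in\mathbb{Q}}x_it^i$ with $x_i\in K$ and well-ordered support $\{i:x_i\neq0\}$. Strings: $\Sigma_p=\{0,\dots,p-1\}$; $\Sigma_p^*$ is the set of finite words over $\Sigma_p$ (including the empty word $\emptyset$); $\mathrm{rev}$ reverses a word. $L_p^0\subset\Sigma_p^*$ is the set of words not beginning with $0$. $L_p$ is the set of words $s_1.s_2$ over $\Sigma_p\cup\{.\}$ with $s_1\in L_p^0$ and $s_2\in\mathrm{rev}(L_p^0)$; for $s=s_1.s_2$, $\|s\|$ is the rational number whose base-$p$ expansion has integer-part digits $s_1$ and fractional digits $s_2$ (a bijection $L_p\to\mathbb{Z}[p^{-1}]_{\ge0}$). For a finite-dimensional $K$-vector space $V$, $\mathrm{End}_{\mathbb{Z}}(V)$ denotes additive endomorphisms; for an automorphism $\psi$ of $K$, $g$ is $\psi$-semilinear if $g(rv)=\psi(r)g(v)$. A function $f:\Sigma_p^*\to\mathrm{End}_{\mathbb{Z}}(V)$ is $\psi$-composed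 if there is a map $\tau$ from $\Sigma_p$ to $\psi$-semilinear endomorphisms of $V$ with $f(a_1\cdots a_n)=\tau(a_1)\circ\cdots\circ\tau(a_n)$, $f(\emptyset)=\mathrm{id}_V$. A function $f:L_p\to\mathrm{End}_{\mathbb{Z}}(V)$ is $\varphi$-biautomatic if there exist a finite-dimensional $K$-vector space $V'$, a $K$-linear injection $\iota:V\to V'$, a $K$-linear surjection $\pi:V'\to V$, a $\varphi$-composed $f_1$ and a $\varphi^{-1}$-composed $f_2$ (both $\Sigma_p^*\to\mathrm{End}_{\mathbb{Z}}(V')$) with $f(s_1.s_2)=\pi\circ f_1(\mathrm{rev}(s_1))\circ f_2(s_2)\circ\iota$ for all $s_1.s_2\in L_p$. $x\in K((t^{\mathbb{Q}}))$ is $p$-automatic if its support lies in $\mathbb{Z}[p^{-1}]_{\ge0}$ and there is a $\varphi$-biautomatic $f:L_p\to\mathrm{End}_{\mathbb{Z}}(K)$ with $x_{\|s\|}=f(s)(1)$ for all $s\in L_p$. $x$ is $p$-quasi-automatic if there exist integers $a>0$, $b\ge0$ such that the support of $x$ is contained in $\{(i-b)/a: i\in\mathbb{Z}[p^{-1}]_{\ge0}\}$ and $\sum_i x_it^{ai+b}$ is $p$-automatic. *)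

(* Defs.v *)
From HB Require Import structures.
From mathcomp Require Import all_boot all_order all_algebra.
From mathcomp Require Import boolp classical_sets fsbigop.
Set Implicit Arguments. Unset Strict Implicit. Unset Printing Implicit Defensive.
Import Order.TTheory GRing.Theory Num.Theory.
Local Open Scope ring_scope.
Local Open Scope classical_set_scope.

Section Hahn.
Variable K : fieldType.

(* An element of K((t^Q)) is represented by its coefficient function rat -> K;
   x i is the coefficient of t^i. *)
Definition hsupport (x : rat -> K) : set rat := [set i | x i != 0].

Definition hahn (x : rat -> K) : Prop :=
  forall A : set rat, A `<=` hsupport x -> A !=set0 ->
    exists2 m, A m & forall a, A a -> (m <= a)%R.

Definition laurent (x : rat -> K) : Prop :=
  hahn x /\ forall i, x i != 0 -> i \is a Num.int.

Definition hadd (x y : rat -> K) : rat -> K := fun i => x i + y i.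

(* Cauchy product: (xy)_k = sum_{i+j=k} x_i y_j (a finite sum for Hahn series). *)
Definition hmul (x y : rat -> K) : rat -> K :=
  fun k => \sum_(i \in [set: rat]) x i * y (k - i).

Definition hone : rat -> K := fun i => if i == 0 then 1 else 0.

Fixpoint hpow (x : rat -> K) (n : nat) : rat -> K :=
  if n is n'.+1 then hmul x (hpow x n') else hone.

Definition integral_over_laurent (x : rat -> K) : Prop :=
  exists (n : nat) (a : 'I_n -> rat -> K),
    (forall j, laurent (a j)) /\
    forall k, hpow x n k + \sum_(j < n) hmul (a j) (hpow x j) k = 0.

End Hahn.

Lemma root_exists (K : closedFieldType) (n : nat) (a : K) :
  exists x : K, x ^+ n.+1 == a.
Proof.
have [x Hx] := @solve_monicpoly K n.+1 (fun i => if i == 0%N then a else 0) isT.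
exists x; apply/eqP; rewrite Hx big_ord_recl /= expr0 mulr1 big1 ?addr0 //.
by move=> i _; rewrite mul0r.
Qed.

Definition frob (K : fieldType) (p : nat) (r : K) : K := r ^+ p.

(* the inverse of the Frobenius x |-> x^p (the unique p-th root, for p > 0) *)
Definition frobinv (K : closedFieldType) (p : nat) (a : K) : K :=
  xchoose (root_exists p.-1 a).

Definition L0 (p : nat) (s : seq 'I_p) : bool :=
  if s is a :: _ then (val a != 0)%N else true.
Definition Lp (p : nat) (s1 s2 : seq 'I_p) : bool := L0 s1 && L0 (rev s2).

(* ||s1.s2|| : base-p value, integer digits s1 (most significant first),
   fractional digits s2 *)
Definition intval (p : nat) (s : seq 'I_p) : rat :=
  foldl (fun acc (d : 'I_p) => acc * p%:R + (val d)%:R) 0 s.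
Definition fracval (p : nat) (s : seq 'I_p) : rat :=
  foldr (fun (d : 'I_p) acc => ((val d)%:R + acc) / p%:R) 0 s.
Definition numval (p : nat) (s1 s2 : seq 'I_p) : rat := intval s1 + fracval s2.

Definition zpnonneg (p : nat) (i : rat) : Prop :=
  exists n k : nat, i = n%:R / (p ^ k)%:R.

Section Auto.
Variable K : fieldType.

Definition semilinear (psi : K -> K) (m : nat) (g : 'rV[K]_m -> 'rV[K]_m) : Prop :=
  (forall u v, g (u + v) = g u + g v) /\ (forall r v, g (r *: v) = psi r *: g v).

Definition composed (p m : nat) (tau : 'I_p -> 'rV[K]_m -> 'rV[K]_m)
  (s : seq 'I_p) : 'rV[K]_m -> 'rV[K]_m :=
  foldr (fun a g => tau a \o g) id s.

Definition is_composed (psi : K -> K) (p m : nat)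
  (f : seq 'I_p -> 'rV[K]_m -> 'rV[K]_m) : Prop :=
  exists tau : 'I_p -> 'rV[K]_m -> 'rV[K]_m,
    (forall a, semilinear psi (tau a)) /\ forall s, f s = composed tau s.

End Auto.

Section Automatic.
Variable K : closedFieldType.
Variable p : nat.

(* f : L_p -> End_Z(K) (with V = K), L_p represented as pairs (s1, s2) *)
Definition biautomatic (f : seq 'I_p -> seq 'I_p -> K -> K) : Prop :=
  exists (m : nat) (iota : K -> 'rV[K]_m) (pi : 'rV[K]_m -> K)
         (f1 f2 : seq 'I_p -> 'rV[K]_m -> 'rV[K]_m),
    (forall r u v, iota (r * u + v) = r *: iota u + iota v) /\ injective iota /\
    (forall r u v, pi (r *: u + v) = r * pi u + pi v) /\
    (forall k, exists u, pi u = k) /\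
    is_composed (frob p) f1 /\ is_composed (frobinv p) f2 /\
    forall s1 s2, Lp s1 s2 -> f s1 s2 = pi \o f1 (rev s1) \o f2 s2 \o iota.

Definition automatic (x : rat -> K) : Prop :=
  (forall i, x i != 0 -> zpnonneg p i) /\
  exists f, biautomatic f /\ forall s1 s2, Lp s1 s2 -> x (numval s1 s2) = f s1 s2 1.

Definition quasi_automatic (x : rat -> K) : Prop :=
  exists (a b : nat), (0 < a)%N /\
    (forall j, x j != 0 -> exists i, zpnonneg p i /\ j = (i - b%:R) / a%:R) /\
    automatic (fun i => x ((i - b%:R) / a%:R)).

End Automatic.

Definition yser (K : fieldType) (x : rat -> K) (n : int) : rat -> K :=
  fun i => if (0 <= i) && (i < 1) then x (n%:~R + i) else 0.

Definition fin_span (K : fieldType) (y : int -> rat -> K) : Prop :=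
  exists (d : nat) (b : 'I_d -> rat -> K),
    forall n, exists c : 'I_d -> K, forall i, y n i = \sum_(j < d) c j * b j i.

(* Main.v *)
Require Import Defs.
From HB Require Import structures.
From mathcomp Require Import all_boot all_order all_algebra.
From mathcomp Require Import boolp classical_sets fsbigop.
From mathcomp Require Import ring lra zify.
Set Implicit Arguments. Unset Strict Implicit. Unset Printing Implicit Defensive.
Import Order.TTheory GRing.Theory Num.Theory.
Local Open Scope ring_scope.
Local Open Scope classical_set_scope.

(** Let [phi] be the [p]-power map and [P] the field of Puiseux series.  Call [x] good if
    the fractional parts [y_n (phi^k x)], for all [n] and [k], span a finite-dimensional
    space.  Since the coefficient of [y_b (u^p)] at [i] is [u_((b+i)/p)^p], such a space is
    stable under the operators which read one fractional digit, and a finite system of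
    these operators is the same thing as an automaton; the integer digits only matter
    through boundedly many prefixes.

    If [x] is good, the [phi^k x] lie in the [K((t))]-span of finitely many functions
    supported in [[0,1)], so [x] satisfies an additive equation [sum_i a_i x^(p^i) = 0]
    over [K((t))].  Conversely an integral [x] satisfies such an equation.  An additive
    polynomial over [P] with [a_0 <> 0] has a nonzero root [z] in [P]: rescale by the
    largest slope of its Newton polygon, take a nonzero root of the residue polynomial,
    and correct it by a contraction.  With [x = z u], the series [u^p - u] satisfies an
    additive equation of smaller degree; so [x] is good by induction, because goodness is
    preserved by multiplication by [P] and by solving Artin-Schreier equations. *)

(** * Well-ordered sets of rationals *)

(** Twists are the obstacle. In a biautomatic function each fractional digit brings an inverse
    Frobenius and each integer digit a Frobenius, so words with different numbers of integer digits
    yield differently twisted coefficients. The series [y_n] live on [[0,1)], so after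
    [i -> a i + b] their integer parts are bounded; [L0_size] then bounds the number of integer
    digits, and finitely many twisted copies suffice. Fractional digits are absorbed by admitting
    all powers [phi^k x]: the [p^k]-th power cancels [k] inverse Frobenius maps. Finite
    dimensionality does not by itself exhibit a bound on the denominators prime to [p], which
    quasi-automaticity asks for. The induction on additive equations therefore carries both
    properties together, as [nice]. In that induction [a_0 = 0] is harmless because [P] is perfect,
    so a [p]-th root of the whole equation can be taken; otherwise the degree drops by Abel
    summation. *)

Definition wo (S : set rat) : Prop :=
  forall A : set rat, A `<=` S -> A !=set0 ->
    exists2 m, A m & forall a, A a -> m <= a.

Lemma wo_ind (S : set rat) (P : rat -> Prop) : wo S ->
  (forall i, S i -> (forall j, S j -> j < i -> P j) -> P i) ->
  forall i, S i -> P i.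
Proof.
move=> woS IH i Si; apply: contrapT => nPi.
have [] := woS [set j | S j /\ ~ P j]; first by move=> j [].
  by exists i.
move=> m [Sm nPm] mmin; apply: nPm; apply: IH => // j Sj jm.
by apply: contrapT => nPj; have := mmin j (conj Sj nPj); rewrite leNgt jm.
Qed.

Lemma wo_sub (S T : set rat) : S `<=` T -> wo T -> wo S.
Proof. by move=> ST woT A AS; apply: woT => a /AS /ST. Qed.

Lemma wo_setU (S T : set rat) : wo S -> wo T -> wo (S `|` T).
Proof.
move=> woS woT A AST [a0 Aa0].
have [/set0P S0 | /negP/set0P S0] := boolP (A `&` S != set0); last first.
  apply: woT; last by exists a0.
  by move=> a Aa; case: (AST a Aa) => // Sa; case: S0; exists a.
have [/set0P T0 | /negP/set0P T0] := boolP (A `&` T != set0); last first.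
  apply: woS; last by exists a0.
  by move=> a Aa; case: (AST a Aa) => // Ta; case: T0; exists a.
have [m [Am Sm] mP] := woS _ (@subIsetr _ A S) S0.
have [n [An Tn] nP] := woT _ (@subIsetr _ A T) T0.
have [mn|nm] := leP m n.
  exists m => // a Aa; case: (AST a Aa) => ?; first exact: mP.
  by apply: le_trans mn _; exact: nP.
exists n => // a Aa; case: (AST a Aa) => ?; last exact: nP.
by apply: le_trans (ltW nm) _; exact: mP.
Qed.

Definition sumset (S T : set rat) : set rat :=
  [set k | exists i j, [/\ S i, T j & k = i + j]].

Lemma wo_sumset (S T : set rat) : wo S -> wo T -> wo (sumset S T).
Proof.
move=> woS woT.
(* Induction on the [S]-component of an element of [A] whose [T]-component is
   minimal: a smaller element of [A] must have a smaller [S]-component. *)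
have main : forall i, S i -> forall (A : set rat) j, A `<=` sumset S T ->
    A (i + j) -> (forall i' j', S i' -> T j' -> A (i' + j') -> j <= j') ->
    exists2 m, A m & forall a, A a -> m <= a.
  apply: (wo_ind woS) => i Si IH A j AST Aij jmin.
  pose A' := [set a | A a /\ a < i + j].
  have [[a [Aa aij]]|A'0] := pselect (exists a, A' a); last first.
    exists (i + j) => // a Aa; rewrite leNgt; apply/negP => aij.
    by apply: A'0; exists a.
  have [i1 [j1 [Si1 Tj1 ea]]] := AST a Aa.
  have [||j' [Tj' [i' [Si' [Aij' ltij']]]] j'min] := woT
    [set j2 | T j2 /\ exists i2, S i2 /\ A' (i2 + j2)].
  - by move=> ? [].
  - by exists j1; split=> //; exists i1; rewrite -ea.
  have jj' := jmin _ _ Si' Tj' Aij'.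
  have [||||m [Am ltm] mmin] := IH i' Si' _ A' j'; first by lra.
  - by move=> b [/AST].
  - by [].
  - by move=> i2 j2 Si2 Tj2 A2; apply: j'min; split=> //; exists i2.
  exists m => // b Ab; have [bl|] := ltP b (i + j); first exact: mmin.
  by apply: le_trans; exact: ltW.
move=> A AST [a Aa]; have [i [j [Si Tj ea]]] := AST a Aa.
have [||j' [Tj' [i' [Si' Aij']]] j'min] := woT
  [set j2 | T j2 /\ exists i2, S i2 /\ A (i2 + j2)].
- by move=> ? [].
- by exists j; split=> //; exists i; rewrite -ea.
apply: (main i' Si' A j') => // i2 j2 Si2 Tj2 A2.
by apply: j'min; split=> //; exists i2.
Qed.

Definition listed (A : set rat) : Prop := exists s : seq rat, forall i, A i -> i \in s.

(* A set well ordered by both <= and >= is finite. *)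
Lemma wo_listed (S T : set rat) (k : rat) : wo S -> wo T ->
  listed [set i | S i /\ T (k - i)].
Proof.
move=> woS woT; set A := [set i | _].
have [[M [AM Mmax]]|noM] := pselect (exists M, A M /\ forall a, A a -> a <= M);
  last first.
  exists [::] => i Ai; exfalso; apply: noM.
  have [||j [Tj Sj] jmin] := woT [set j | T j /\ S (k - j)].
  - by move=> ? [].
  - by exists (k - i); case: Ai => Si Ti; split=> //=; rewrite subKr.
  exists (k - j); split; first by split=> //; rewrite subKr.
  move=> a [Sa Ta]; have /= := jmin (k - a); rewrite subKr => H.
  by have := H (conj Ta Sa); lra.
have main : forall i, S i -> A i -> listed [set a | A a /\ a <= i].
  apply: (wo_ind woS) => i Si IH Ai.
  have [[b [Ab bi]]|nob] := pselect (exists b, A b /\ b < i); last first.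
    exists [:: i] => a [Aa ai]; rewrite inE; move: ai; rewrite le_eqVlt => /orP[//|ai].
    by case: nob; exists a.
  (* The element [k - j] is the predecessor of [i] in [A]: the least [j] on the [T] side gives the
     greatest [k - j] below [i]. Induction lists everything up to it. *)
  have [||j [Tj [Sj ji]] jmin] := woT [set j | T j /\ (S (k - j) /\ k - j < i)].
  - by move=> ? [].
  - by exists (k - b); case: Ab => Sb Tb; split=> //=; rewrite subKr.
  have [s Hs] : listed [set a | A a /\ a <= k - j].
    by apply: IH => //; split=> //; rewrite subKr.
  exists (i :: s) => a [Aa ai]; rewrite inE; move: ai; rewrite le_eqVlt.
  move=> /orP[-> //|ai]; apply/orP; right; apply: Hs; split=> //.
  have /= := jmin (k - a); rewrite subKr => H.
  by case: Aa => Sa Ta; have := H (conj Ta (conj Sa ai)); lra.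
have [s Hs] := main M (proj1 AM) AM.
by exists s => i Ai; apply: Hs; split=> //; exact: Mmax.
Qed.

(** * The ring of Hahn series *)

Section HahnRing.
Variable K : fieldType.
Implicit Types x y z : rat -> K.

(** The finite-support sum is traded for a sum over any duplicate-free list containing the
    contributing indices. The freedom to enlarge the list is what makes different products
    comparable. *)
Lemma hmulE x y k (s : seq rat) : uniq s ->
  (forall i, x i != 0 -> y (k - i) != 0 -> i \in s) ->
  hmul x y k = \sum_(i <- s) x i * y (k - i).
Proof.
move=> us H; rewrite /hmul fsbig_supp (@fsbig_fwiden _ _ _ _ s) //.
  move=> i [_ /= /eqP]; rewrite mulf_eq0 negb_or => /andP[]; exact: H.
move=> i [/= _ nA] /=; apply: contrapT => nz; apply: nA; split=> //=.
Qed.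

Lemma hmul_fin x y k : hahn x -> hahn y -> exists s : seq rat, uniq s /\
  forall i, x i != 0 -> y (k - i) != 0 -> i \in s.
Proof.
move=> hx hy; have [s Hs] := wo_listed k hx hy.
by exists (undup s); split=> [|i xi yi]; rewrite ?undup_uniq // mem_undup; apply: Hs.
Qed.

Lemma hsupport_hmul x y : hsupport (hmul x y) `<=` sumset (hsupport x) (hsupport y).
Proof.
move=> k /= nz; apply: contrapT => H; move/eqP: nz; apply.
rewrite (hmulE (s := [::])) ?big_nil // => i xi yi.
by case: H; exists i, (k - i); split=> //; rewrite addrC subrK.
Qed.

Lemma hahn_mul x y : hahn x -> hahn y -> hahn (hmul x y).
Proof. by move=> hx hy; apply: wo_sub (@hsupport_hmul x y) (wo_sumset hx hy). Qed.

Lemma hahn_add x y : hahn x -> hahn y -> hahn (hadd x y).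
Proof.
move=> hx hy; apply: wo_sub (wo_setU hx hy) => i; rewrite /hsupport /= /hadd.
by have [->|xi _] := eqVneq (x i) 0; [rewrite add0r; right | left].
Qed.

Lemma hahn_sub x y : (forall i, y i != 0 -> x i != 0) -> hahn x -> hahn y.
Proof. by move=> xy; apply: wo_sub. Qed.

Lemma hahn_finsupp x (s : seq rat) : (forall i, x i != 0 -> i \in s) -> hahn x.
Proof.
elim: s x => [|a s IH] x H.
  by move=> A AS [b /AS /= /H].
pose y i := if i == a then 0 else x i.
have wo1 : wo [set a].
  by move=> A AS [b Ab]; exists b => // c /AS ->; rewrite (AS _ Ab).
apply: wo_sub (wo_setU wo1 (IH y _)).
  move=> i xi; have [->|ia] := eqVneq i a; first by left.
  by right; rewrite /hsupport /= /y (negPf ia).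
move=> i; rewrite /y; case: (eqVneq i a) => [|ia /H]; first by rewrite eqxx.
by rewrite inE (negPf ia).
Qed.

Lemma hahn_bounded x : hahn x -> exists c, forall i, x i != 0 -> c <= i.
Proof.
move=> hx; have [[i xi]|nx] := pselect (exists i, x i != 0).
  by have [//||m _ mP] := hx [set i | x i != 0]; [exists i|exists m].
by exists 0 => i xi; case: nx; exists i.
Qed.

Lemma hmulC x y : hmul x y = hmul y x.
Proof.
apply/funext => k; rewrite /hmul (reindex_fsbigT (fun i => k - i)) /=.
  by apply: eq_fsbigr => i _; rewrite subKr addrC mulrC.
by exists (fun i => k - i) => i; rewrite subKr.
Qed.

(** Both sides become sums over pairs [(i, m)], where [m] is the exponent of the product of an
    [x]-term and a [y]-term. The list [s1] of possible [m] is finite because the sumset of the two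
    supports is well ordered; [s2] then collects the possible [i]. *)
Lemma hmulA x y z : hahn x -> hahn y -> hahn z ->
  hmul x (hmul y z) = hmul (hmul x y) z.
Proof.
move=> hx hy hz; apply/funext => k.
have [s1 [us1 Hs1]] : exists s : seq rat, uniq s /\ forall i j, x i != 0 ->
    y j != 0 -> z (k - (i + j)) != 0 -> i + j \in s.
  have [s Hs] := wo_listed k (wo_sumset hx hy) hz.
  exists (undup s); split=> [|i j xi yj zl]; rewrite ?undup_uniq // mem_undup.
  by apply: Hs; split=> //; exists i, j.
have [s2 [us2 Hs2]] : exists s : seq rat, uniq s /\ forall m i, m \in s1 ->
    x i != 0 -> y (m - i) != 0 -> i \in s.
  elim: s1 {us1 Hs1} => [|m s1 [s [us Hs]]]; first by exists [::].
  have [s' [us' Hs']] := hmul_fin m hx hy.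
  exists (undup (s ++ s')); rewrite undup_uniq; split=> // m' i.
  rewrite inE mem_undup mem_cat => /orP[/eqP ->|m's1] xi yi.
    by rewrite Hs' // orbT.
  by rewrite (Hs m').
have nzS (I : eqType) (s : seq I) (F : I -> K) : \sum_(i <- s) F i != 0 ->
    exists2 i, i \in s & F i != 0.
  move=> nz; apply: contrapT => H; move/eqP: nz; apply; rewrite big_seq big1 // => i si.
  by apply: contrapT => /eqP Fi; apply: H; exists i.
rewrite [RHS](hmulE (s := s1)) //; last first.
  move=> m /hsupport_hmul[i [j [xi yj ->]]]; exact: Hs1.
under [RHS]eq_big_seq => m ms1.
  rewrite (hmulE us2); last by move=> i; exact: Hs2.
  rewrite mulr_suml; over.
rewrite exchange_big /= (hmulE us2); last first.
  move=> i xi /hsupport_hmul[j [l [yj zl e]]].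
  have e1 : k - (i + j) = l by lra.
  have := Hs1 i j xi yj; rewrite e1 => /(_ zl) ms1.
  by apply: (Hs2 (i + j)) => //; rewrite addrC addrA addNr add0r.
apply: eq_bigr => i _; have [->|xi] := eqVneq (x i) 0.
  by rewrite mul0r big1 // => m _; rewrite !mul0r.
rewrite (hmulE (s := [seq m - i | m <- s1])); first last.
- move=> j yj zl; apply/mapP; exists (i + j); last by rewrite addrC addrA addNr add0r.
  by apply: Hs1 => //; rewrite opprD addrA.
- by rewrite map_inj_uniq // => a b /addIr.
rewrite big_map mulr_sumr; apply: eq_bigr => m _; rewrite mulrA; congr (_ * z _); ring.
Qed.

Lemma hmulDl x y z : hahn x -> hahn y -> hahn z ->
  hmul (hadd x y) z = hadd (hmul x z) (hmul y z).
Proof.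
move=> hx hy hz; apply/funext => k; rewrite /hadd.
have [s1 [us1 Hs1]] := hmul_fin k hx hz; have [s2 [us2 Hs2]] := hmul_fin k hy hz.
pose s := undup (s1 ++ s2).
have us : uniq s by rewrite undup_uniq.
have ins i : (i \in s) = (i \in s1) || (i \in s2) by rewrite mem_undup mem_cat.
rewrite !(hmulE us) -?big_split /=; first by apply: eq_bigr => i _; rewrite mulrDl.
- by move=> i yi zi; rewrite ins Hs2 ?orbT.
- by move=> i xi zi; rewrite ins Hs1.
- move=> i; have [->|xi _ zi] := eqVneq (x i) 0; last by rewrite ins Hs1.
  by rewrite add0r ins => yi zi; rewrite Hs2 ?orbT.
Qed.

Definition hmono (c : K) (s : rat) : rat -> K := fun i => if i == s then c else 0.

Lemma hahn_mono c s : hahn (hmono c s).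
Proof.
by apply: (@hahn_finsupp _ [:: s]) => i; rewrite /hmono inE; case: ifP; rewrite ?eqxx.
Qed.

Lemma hmul_mono c s x k : hmul (hmono c s) x k = c * x (k - s).
Proof.
rewrite (hmulE (s := [:: s])) // ?big_seq1 /hmono ?eqxx // => i.
by rewrite inE; case: ifP; rewrite ?eqxx.
Qed.

Definition hopp x : rat -> K := fun i => - x i.

(** The Boolean form of [hahn] makes the projection injective, so equalities in the ring reduce to
    equalities of coefficients. *)
Record hseries := HSeries { hcoef :> rat -> K; _ : `[< hahn hcoef >] }.

HB.instance Definition _ := [isSub for hcoef].
HB.instance Definition _ := [Choice of hseries by <:].

Lemma hseriesP (x : hseries) : hahn x.
Proof. by case: x => x hx /=; apply/asboolP. Qed.

Definition mkH x (hx : hahn x) : hseries := HSeries (asboolT hx).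

Lemma hseries_eq (x y : hseries) : (forall i, x i = y i) -> x = y.
Proof. by move=> xy; apply/val_inj/funext. Qed.

Lemma hahn_opp x : hahn x -> hahn (hopp x).
Proof. by apply: hahn_sub => i; rewrite /hopp oppr_eq0. Qed.

Lemma hahn_zero : hahn (fun _ => 0 : K).
Proof. by apply: (@hahn_finsupp _ [::]) => i; rewrite eqxx. Qed.

Definition hs_zero : hseries := mkH hahn_zero.
Definition hs_one : hseries := mkH (@hahn_mono 1 0).
Definition hs_opp (x : hseries) : hseries := mkH (hahn_opp (@hseriesP x)).
Definition hs_add (x y : hseries) : hseries := mkH (hahn_add (@hseriesP x) (@hseriesP y)).
Definition hs_mul (x y : hseries) : hseries := mkH (hahn_mul (@hseriesP x) (@hseriesP y)).

Lemma hs_addA : associative hs_add.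
Proof. by move=> x y z; apply: hseries_eq => i; rewrite /= /hadd addrA. Qed.
Lemma hs_addC : commutative hs_add.
Proof. by move=> x y; apply: hseries_eq => i; rewrite /= /hadd addrC. Qed.
Lemma hs_add0 : left_id hs_zero hs_add.
Proof. by move=> x; apply: hseries_eq => i; rewrite /= /hadd add0r. Qed.
Lemma hs_addN : left_inverse hs_zero hs_opp hs_add.
Proof. by move=> x; apply: hseries_eq => i; rewrite /= /hadd addNr. Qed.

HB.instance Definition _ := GRing.isZmodule.Build hseries hs_addA hs_addC hs_add0 hs_addN.

Lemma hs_mulA : associative hs_mul.
Proof.
by move=> x y z; apply/val_inj/hmulA; exact: hseriesP.
Qed.
Lemma hs_mulC : commutative hs_mul.
Proof. by move=> x y; apply/val_inj/hmulC. Qed.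
Lemma hs_mul1 : left_id hs_one hs_mul.
Proof. by move=> x; apply: hseries_eq => i; rewrite /= hmul_mono mul1r subr0. Qed.
Lemma hs_mulDl : left_distributive hs_mul hs_add.
Proof. by move=> x y z; apply/val_inj/hmulDl; exact: hseriesP. Qed.
Lemma hs_one_neq0 : hs_one != 0.
Proof.
apply/eqP => /(congr1 (fun x : hseries => x 0)) /= /eqP.
by rewrite /hmono eqxx oner_eq0.
Qed.

HB.instance Definition _ :=
  GRing.Zmodule_isComNzRing.Build hseries hs_mulA hs_mulC hs_mul1 hs_mulDl hs_one_neq0.

Lemma hcoefD (x y : hseries) i : (x + y) i = x i + y i. Proof. by []. Qed.
Lemma hcoefN (x : hseries) i : (- x) i = - x i. Proof. by []. Qed.
Lemma hcoefB (x y : hseries) i : (x - y) i = x i - y i. Proof. by []. Qed.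
Lemma hcoef0 i : (0 : hseries) i = 0. Proof. by []. Qed.
Lemma hcoef1 i : (1 : hseries) i = if i == 0 then 1 else 0. Proof. by []. Qed.
Lemma hcoefM (x y : hseries) : hcoef (x * y) = hmul x y. Proof. by []. Qed.

Lemma hcoef_sum (I : Type) (r : seq I) (P : pred I) (F : I -> hseries) i :
  (\sum_(j <- r | P j) F j) i = \sum_(j <- r | P j) F j i.
Proof.
by elim/big_rec2: _ => // j u v _ <-.
Qed.

Lemma hpowE (x : hseries) n : hpow x n = hcoef (x ^+ n).
Proof. by elim: n => [//|n IH] /=; rewrite exprS hcoefM IH. Qed.

Definition mono (c : K) (s : rat) : hseries := mkH (@hahn_mono c s).

Lemma hcoef_mono c s i : mono c s i = if i == s then c else 0. Proof. by []. Qed.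
Lemma hcoef_monoM c s (x : hseries) k : (mono c s * x) k = c * x (k - s).
Proof. exact: hmul_mono. Qed.

Lemma monoM c d s r : mono c s * mono d r = mono (c * d) (s + r).
Proof.
apply: hseries_eq => i; rewrite hcoef_monoM !hcoef_mono subr_eq addrC.
by case: eqP; rewrite ?mulr0.
Qed.

Lemma mono1 : mono 1 0 = 1. Proof. exact: hseries_eq. Qed.

Lemma monoX c s n : mono c s ^+ n = mono (c ^+ n) (s *+ n).
Proof. by elim: n => [|n IH]; rewrite ?expr0 ?mulr0n ?mono1 // !exprS mulrS IH monoM. Qed.

End HahnRing.

(** * Frobenius powers, valuations and Puiseux series *)

Section CharP.
Variables (R : comNzRingType) (p : nat).
Hypothesis pR : p \in [pchar R].

Lemma pexpD k (x y : R) : (x + y) ^+ (p ^ k) = x ^+ (p ^ k) + y ^+ (p ^ k).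
Proof.
apply: exprDn_pchar; rewrite pnatX; apply/orP; left.
by rewrite pnatE ?(pcharf_prime pR).
Qed.

Lemma pexp0 k : (0 : R) ^+ (p ^ k) = 0.
Proof. by rewrite expr0n expn_eq0 -leqn0 leqNgt (prime_gt0 (pcharf_prime pR)). Qed.

Lemma pexpB k (x y : R) : (x - y) ^+ (p ^ k) = x ^+ (p ^ k) - y ^+ (p ^ k).
Proof. by apply/eqP; rewrite -(inj_eq (addIr (y ^+ (p ^ k)))) -pexpD !subrK. Qed.

Lemma pexp_sum k (I : Type) (r : seq I) (P : pred I) (F : I -> R) :
  (\sum_(i <- r | P i) F i) ^+ (p ^ k) = \sum_(i <- r | P i) F i ^+ (p ^ k).
Proof.
elim/big_rec2: _ => [|i u v _ <-]; first exact: pexp0.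
exact: pexpD.
Qed.

End CharP.

Lemma pcharfP_gt0 (p k : nat) : prime p -> 0 < (p ^ k)%:R :> rat.
Proof. by move=> pp; rewrite ltr0n expn_gt0 prime_gt0. Qed.

Section Puiseux.
Variable K : fieldType.
Implicit Types x y z : hseries K.

Definition vge (c : rat) (x : rat -> K) : Prop := forall i, x i != 0 -> c <= i.
Definition puis (a : nat) (x : rat -> K) : Prop :=
  forall i, x i != 0 -> a%:R * i \is a Num.int.

Lemma hcoefM_neq0 x y k : (x * y) k != 0 -> exists i j, [/\ x i != 0, y j != 0 & k = i + j].
Proof. exact: (@hsupport_hmul K x y). Qed.

Lemma hcoefD_neq0 x y k : (x + y) k != 0 -> x k != 0 \/ y k != 0.
Proof.
rewrite hcoefD; have [->|] := eqVneq (x k) 0; last by left.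
by rewrite add0r; right.
Qed.

Lemma vgeD c x y : vge c x -> vge c y -> vge c (x + y).
Proof. by move=> cx cy i /hcoefD_neq0[/cx|/cy]. Qed.
Lemma vgeN c x : vge c x -> vge c (- x).
Proof. by move=> cx i; rewrite hcoefN oppr_eq0 => /cx. Qed.
Lemma vgeB c x y : vge c x -> vge c y -> vge c (x - y).
Proof. by move=> cx cy; apply: vgeD => //; exact: vgeN. Qed.
Lemma vgeM c d x y : vge c x -> vge d y -> vge (c + d) (x * y).
Proof. by move=> cx cy k /hcoefM_neq0[i [j [/cx ci /cy dj ->]]]; exact: lerD. Qed.
Lemma vge_le c d x : c <= d -> vge d x -> vge c x.
Proof. by move=> cd dx i /dx; exact: le_trans. Qed.
Lemma vge0 c : vge c (0 : hseries K).
Proof. by move=> i; rewrite hcoef0 eqxx. Qed.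
Lemma vge_mono c s : vge s (mono c s).
Proof. by move=> i; rewrite hcoef_mono; case: (eqVneq i s) => [->|]; rewrite ?eqxx. Qed.
Lemma vge_sum c (I : Type) (r : seq I) (P : pred I) (F : I -> hseries K) :
  (forall i, P i -> vge c (F i)) -> vge c (\sum_(i <- r | P i) F i).
Proof.
move=> H; apply: (big_ind (fun x : hseries K => vge c x)) => //; first exact: vge0.
by move=> x y; exact: vgeD.
Qed.

Lemma puisD a x y : puis a x -> puis a y -> puis a (x + y).
Proof. by move=> cx cy i /hcoefD_neq0[/cx|/cy]. Qed.
Lemma puisN a x : puis a x -> puis a (- x).
Proof. by move=> cx i; rewrite hcoefN oppr_eq0 => /cx. Qed.
Lemma puisB a x y : puis a x -> puis a y -> puis a (x - y).
Proof. by move=> cx cy; apply: puisD => //; exact: puisN. Qed.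
Lemma puisM a x y : puis a x -> puis a y -> puis a (x * y).
Proof. by move=> cx cy k /hcoefM_neq0[i [j [/cx ci /cy dj ->]]]; rewrite mulrDr rpredD. Qed.
Lemma puis0 a : puis a (0 : hseries K).
Proof. by move=> i; rewrite hcoef0 eqxx. Qed.
Lemma puis_mono a c s : a%:R * s \is a Num.int -> puis a (mono c s).
Proof. by move=> h i; rewrite hcoef_mono; case: (eqVneq i s) => [->|]; rewrite ?eqxx. Qed.
Lemma puis1 a : puis a (1 : hseries K).
Proof. by rewrite -mono1; apply: puis_mono; rewrite mulr0 rpred0. Qed.
Lemma puisX a x n : puis a x -> puis a (x ^+ n).
Proof.
move=> ax; elim: n => [|n IH]; first by rewrite expr0; exact: puis1.
by rewrite exprS; exact: puisM.
Qed.
Lemma puis_sum a (I : Type) (r : seq I) (P : pred I) (F : I -> hseries K) :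
  (forall i, P i -> puis a (F i)) -> puis a (\sum_(i <- r | P i) F i).
Proof.
move=> H; apply: (big_ind (fun x : hseries K => puis a x)) => //; first exact: puis0.
by move=> x y; exact: puisD.
Qed.
Lemma puis_dvd a b (x : rat -> K) : (a %| b)%N -> puis a x -> puis b x.
Proof.
case/dvdnP => c -> ax i /ax H.
by rewrite natrM -mulrA rpredM ?rpred_nat // intr_nat.
Qed.

Lemma hahn_puis a c (x : rat -> K) : (0 < a)%N -> puis a x -> vge c x -> hahn x.
Proof.
move=> a0 ax cx A AS [b0 Ab0]; have ra : 0 < a%:R :> rat by rewrite ltr0n.
pose B := Num.bound (a%:R * `|c|).
have nat_of i : A i -> exists n : nat, a%:R * i + B%:R = n%:R.
  move=> /AS xi; apply/natrP; rewrite natrEint rpredD ?ax ?rpred_nat //=.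
  have : a%:R * `|c| < B%:R by apply: archi_boundP; rewrite mulr_ge0.
  have := cx _ xi; have := ler_norm (- c); rewrite normrN => h1 h2.
  have : a%:R * - `|c| <= a%:R * i by rewrite ler_pM2l //; lra.
  lra.
have ex : exists n : nat, `[< exists i, A i /\ a%:R * i + B%:R = n%:R >].
  by have [n e] := nat_of _ Ab0; exists n; apply/asboolP; exists b0.
case: (ex_minnP ex) => n /asboolP[m [Am em]] nmin; exists m => // i Ai.
have [k ek] := nat_of _ Ai; have : (n <= k)%N by apply: nmin; apply/asboolP; exists i.
by rewrite -(ler_nat rat) -em -ek lerD2r ler_pM2l.
Qed.

(** Exponents are multiples of [1/a], so the first positive one is at least [1/a]. This gap supplies
    the initial valuation in the uses of [contraction]. *)
Lemma vge_pos a x : (0 < a)%N -> puis a x -> vge 0 x -> x 0 = 0 -> vge (a%:R^-1) x.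
Proof.
move=> a0 ax cx x0 i xi; have ra : 0 < a%:R :> rat by rewrite ltr0n.
have i0 : 0 < i.
  by rewrite lt_neqAle cx // andbT; apply: contraNneq xi => <-; rewrite x0.
have /intrP[m em] := ax _ xi.
have : 0 < a%:R * i by rewrite mulr_gt0.
rewrite em ltr0z => m0; rewrite -(ler_pM2l ra) mulfV ?gt_eqF // em.
by rewrite -[1]/(1%:~R) ler_int.
Qed.

(** Iterate [e -> r + S e] from 0. Successive differences gain [1/a] in valuation, so every
    coefficient stabilizes, and the common denominator [a] keeps the limit a Hahn series. Only
    additivity of [S] is asked, since [S] will be a polynomial in Frobenius. *)
Lemma contraction a c (r : hseries K) (S : hseries K -> hseries K) : (0 < a)%N ->
  puis a r -> vge c r -> {morph S : x y / x - y} ->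
  (forall x (d : rat), c <= d -> puis a x -> vge d x -> puis a (S x) /\ vge (d + a%:R^-1) (S x)) ->
  exists e : hseries K, [/\ puis a e, vge c e & e = r + S e].
Proof.
move=> a0 ar cr SB Sc; have ra : 0 < a%:R :> rat by rewrite ltr0n.
have S0 : S 0 = 0 by have := SB 0 0; rewrite subr0 subrr.
pose E n := iter n (fun e => r + S e) 0.
have ES n : E n.+1 = r + S (E n) by [].
have EP n : puis a (E n) /\ vge c (E n).
  elim: n => [|n [IH1 IH2]]; first by split; [exact: puis0 | exact: vge0].
  have [s1 s2] := Sc _ _ (lexx c) IH1 IH2; split; first exact: puisD.
  by apply: vgeD => //; apply: vge_le s2; rewrite lerDl invr_ge0 ltW.
have step n : vge (c + n%:R / a%:R) (E n.+1 - E n).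
  elim: n => [|n IH]; first by rewrite ES S0 !addr0 subr0 mul0r addr0.
  have -> : E n.+2 - E n.+1 = S (E n.+1 - E n).
    by rewrite SB !ES opprD addrACA subrr add0r.
  have [|||_] := Sc (E n.+1 - E n) (c + n%:R / a%:R).
  - by rewrite lerDl divr_ge0.
  - by apply: puisB; case: (EP n) => //; case: (EP n.+1).
  - exact: IH.
  by rewrite -addrA -natr1 mulrDl mul1r.
have stab n m (i : rat) : (n <= m)%N -> i < c + n%:R / a%:R -> E m i = E n i.
  move=> nm il; rewrite -(subnKC nm); elim: (m - n)%N => [|d IH]; first by rewrite addn0.
  rewrite addnS -[E (n + d).+1](subrK (E (n + d)%N)) hcoefD IH.
  have [->|nz] := eqVneq ((E (n + d).+1 - E (n + d)%N) i) 0; first by rewrite add0r.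
  have := step _ _ nz; rewrite natrD mulrDl => h.
  have dge : 0 <= d%:R / a%:R :> rat by rewrite divr_ge0.
  by move: il; rewrite ltNge => /negP; case; apply: le_trans h; rewrite addrA lerDl.
(* From step [N i] on the coefficient at [i] is constant, so [s] is the coefficientwise limit of
   [E]. *)
pose N (i : rat) := Num.bound `|a%:R * (i - c)|.
have Nlt (i : rat) : i < c + (N i)%:R / a%:R.
  rewrite -ltrBlDl ltr_pdivlMr // mulrC.
  by apply: le_lt_trans (ler_norm _) _; apply: archi_boundP.
pose s i := E (N i) i.
have sa : puis a s by move=> i; case: (EP (N i)) => + _; exact.
have sc : vge c s by move=> i; case: (EP (N i)) => _; exact.
pose e := mkH (hahn_puis a0 sa sc).
have eE n : vge (c + n%:R / a%:R) (e - E n).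
  move=> i nz; rewrite leNgt; apply/negP => il; move/eqP: nz; apply.
  rewrite hcoefB /= /s; have [nN|Nn] := leqP n (N i).
    by rewrite (stab n (N i)) // subrr.
  by rewrite (stab (N i) n) ?subrr // ltnW.
exists e; split=> //; apply: hseries_eq => i; apply/eqP; rewrite -subr_eq0.
apply/negPn/negP; rewrite -[e i - _]/((e - (r + S e)) i).
(* Both terms on the right have valuation at least [c + N i / a], which exceeds [i]. *)
have -> : e - (r + S e) = (e - E (N i).+1) - S (e - E (N i)).
  by rewrite SB ES; ring.
have h : vge (c + (N i)%:R / a%:R) ((e - E (N i).+1) - S (e - E (N i))).
  apply: vgeB.
    by apply: vge_le (eE _); rewrite lerD2l ler_pM2r ?invr_gt0 // ler_nat.
  have [|||_] := Sc (e - E (N i)) (c + (N i)%:R / a%:R).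
  - by rewrite lerDl divr_ge0.
  - by apply: puisB => //; case: (EP (N i)).
  - exact: eE.
  by apply: vge_le; rewrite lerDl invr_ge0 ltW.
by move/h; rewrite leNgt Nlt.
Qed.

Lemma hseries_lead x : x != 0 -> exists2 v, x v != 0 & vge v x.
Proof.
move=> nx; have [//||v xv vP] := hseriesP (x := x) (A := [set i | x i != 0]); last by exists v.
apply: contrapT => H; move/eqP: nx; apply; apply: hseries_eq => i.
by apply: contrapT => /eqP xi; apply: H; exists i.
Qed.

(** The monomial [m] inverts the leading term, so [u = 1 - m x] has positive valuation. The
    geometric series in [u], obtained as the fixed point [g = 1 + u g], gives the inverse [g m]. *)
Lemma puis_inv_lead a v x : (0 < a)%N -> puis a x -> x v != 0 -> vge v x ->
  exists y : hseries K, [/\ puis a y, vge (- v) y & y * x = 1].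
Proof.
move=> a0 ax xv vP; have ra : 0 < a%:R :> rat by rewrite ltr0n.
pose m := mono (x v)^-1 (- v).
have am : puis a m by apply: puis_mono; rewrite mulrN rpredN ax.
pose u := 1 - m * x.
have au : puis a u by apply: puisB; [exact: puis1 | exact: puisM].
have u0 : vge (a%:R^-1) u.
  apply: vge_pos => //.
    apply: vgeB; first by rewrite -mono1; exact: vge_mono.
    by rewrite -(addNr v); apply: vgeM => //; exact: vge_mono.
  by rewrite hcoefB hcoef1 eqxx hcoef_monoM opprK add0r mulVf ?subrr.
have [|||g [ag g0 eg]] := @contraction a 0 1 (fun g => u * g) a0 (@puis1 a).
- by rewrite -mono1; exact: vge_mono.
- by move=> y z; rewrite mulrBr.
- move=> y d _ ay dy; split; first exact: puisM.
  by rewrite addrC; exact: vgeM.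
exists (g * m); split; first exact: puisM.
  by rewrite -[- v]add0r; apply: vgeM => //; exact: vge_mono.
by rewrite -mulrA mulrC; move: eg; rewrite /u mulrBl mul1r addrCA => /eqP;
  rewrite -subr_eq0 opprD addrA subrr add0r opprB subr_eq0 => /eqP.
Qed.

Lemma puis_inv a x : (0 < a)%N -> puis a x -> x != 0 ->
  exists2 y : hseries K, puis a y & y * x = 1.
Proof.
move=> a0 ax nx; have [v xv vP] := hseries_lead nx.
by have [y [ay _ e]] := puis_inv_lead a0 ax xv vP; exists y.
Qed.

Lemma hcoefM_lead c d x y : vge c x -> vge d y -> (x * y) (c + d) = x c * y d.
Proof.
move=> cx dy; rewrite hcoefM (hmulE (s := [:: c])) //.
  by rewrite big_seq1 addrC addKr.
move=> i /cx ci /dy di; rewrite inE eq_le ci andbT.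
by move: di; rewrite lerBrDl lerD2r.
Qed.

Definition isP x : Prop := exists2 a, (0 < a)%N & puis a x.

Lemma puis_mull a b (x : rat -> K) : puis a x -> puis (a * b) x.
Proof. by apply: puis_dvd; exact: dvdn_mulr. Qed.
Lemma puis_mulr a b (x : rat -> K) : puis b x -> puis (a * b) x.
Proof. by apply: puis_dvd; exact: dvdn_mull. Qed.

Lemma isP0 : isP 0. Proof. by exists 1%N => //; exact: puis0. Qed.
Lemma isPD x y : isP x -> isP y -> isP (x + y).
Proof.
case=> a a0 ax [b b0 bx]; exists (a * b)%N; first by rewrite muln_gt0 a0.
by apply: puisD; [exact: puis_mull | exact: puis_mulr].
Qed.
Lemma isPM x y : isP x -> isP y -> isP (x * y).
Proof.
case=> a a0 ax [b b0 bx]; exists (a * b)%N; first by rewrite muln_gt0 a0.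
by apply: puisM; [exact: puis_mull | exact: puis_mulr].
Qed.
Lemma isPX x n : isP x -> isP (x ^+ n).
Proof. by case=> a a0 ax; exists a => //; exact: puisX. Qed.
Lemma isP_sum n (F : 'I_n -> hseries K) : (forall i, isP (F i)) -> isP (\sum_i F i).
Proof.
by move=> H; apply: (big_ind isP) => //; [exact: isP0 | exact: isPD].
Qed.
Lemma isP_mono c s : isP (mono c s).
Proof.
exists `|denq s|%N; first by rewrite absz_gt0 denq_neq0.
apply: puis_mono; rewrite -[(`|_|%N)%:R]/((Posz `|denq s|%N)%:~R) gez0_abs ?denq_ge0 //.
by rewrite mulrC -numqE intr_int.
Qed.
Lemma isP_inv x : isP x -> x != 0 -> exists2 y, isP y & y * x = 1.
Proof.
by case=> a a0 ax nx; have [y ay e] := puis_inv a0 ax nx; exists y => //; exists a.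
Qed.

Lemma common_puis n (F : nat -> hseries K) : (forall i, (i < n)%N -> isP (F i)) ->
  exists2 a, (0 < a)%N & forall i, (i < n)%N -> puis a (F i).
Proof.
elim: n => [|n IH] H; first by exists 1%N.
have [|a a0 aF] := IH; first by move=> i /ltnW; exact: H.
have [b b0 bF] := H n (ltnSn n).
exists (a * b)%N => [|i]; first by rewrite muln_gt0 a0.
rewrite ltnS leq_eqVlt => /orP[/eqP ->|/aF]; [exact: puis_mulr | exact: puis_mull].
Qed.

End Puiseux.

Section Frobenius.
Variables (K : fieldType) (p : nat).
Hypothesis pK : p \in [pchar K].
Implicit Types x y z : hseries K.

Let pp : prime p := pcharf_prime pK.

Lemma pcharH : p \in [pchar (hseries K)].
Proof.
rewrite inE pp /=; apply/eqP/hseries_eq => i; rewrite hcoef0.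
have -> n : (n%:R : hseries K) i = (1 : hseries K) i *+ n.
  by elim: n => [|n IH] //; rewrite !mulrS hcoefD IH.
exact: mulrn_pchar.
Qed.

Lemma ltsuppX c x n : (0 < n)%N -> (forall i, x i != 0 -> i < c) ->
  forall i, (x ^+ n) i != 0 -> i < c *+ n.
Proof.
case: n => // n _ xc; elim: n => [|n IH] i; first by rewrite expr1 mulr1n; exact: xc.
by rewrite exprS mulrS => /hcoefM_neq0[j [l [/xc jc /IH ln ->]]]; exact: ltrD.
Qed.

Lemma gtsuppX c x n : (0 < n)%N -> (forall i, x i != 0 -> c < i) ->
  forall i, (x ^+ n) i != 0 -> c *+ n < i.
Proof.
case: n => // n _ xc; elim: n => [|n IH] i; first by rewrite expr1 mulr1n; exact: xc.
by rewrite exprS mulrS => /hcoefM_neq0[j [l [/xc jc /IH ln ->]]]; exact: ltrD.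
Qed.

(* Split [x] at the exponent [i / q]: in characteristic [p] the three parts
   contribute separately to the [q]-th power, and only the middle one reaches [i]. *)
Lemma hcoefX x k i : (x ^+ (p ^ k)) i = x (i / (p ^ k)%:R) ^+ (p ^ k).
Proof.
set q := (p ^ k)%N; have q0 : (0 < q)%N by rewrite expn_gt0 prime_gt0.
have qr : 0 < q%:R :> rat by rewrite ltr0n.
set s := i / q%:R; have es : s *+ q = i by rewrite -mulr_natr divfK ?gt_eqF.
have hl : hahn (fun j => if j < s then x j else 0).
  by apply: hahn_sub (hseriesP (x := x)) => j; case: ifP; rewrite ?eqxx.
have hg : hahn (fun j => if s < j then x j else 0).
  by apply: hahn_sub (hseriesP (x := x)) => j; case: ifP; rewrite ?eqxx.
have -> : x = mkH hl + mono (x s) s + mkH hg.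
  apply: hseries_eq => j; rewrite !hcoefD hcoef_mono /=.
  by case: (ltgtP j s) => [_|_|->]; rewrite ?addr0 ?add0r.
rewrite !(pexpD pcharH) monoX -/q es !hcoefD !hcoef_mono /= !ltxx !eqxx !addr0 !add0r.
have -> : (mkH hl ^+ q) i = 0.
  have H : forall j, mkH hl j != 0 -> j < s by move=> j /=; case: ifP; rewrite ?eqxx.
  by apply: contrapT => /eqP /(ltsuppX q0 H); rewrite es ltxx.
have -> : (mkH hg ^+ q) i = 0.
  have H : forall j, mkH hg j != 0 -> s < j by move=> j /=; case: ifP; rewrite ?eqxx.
  by apply: contrapT => /eqP /(gtsuppX q0 H); rewrite es ltxx.
by rewrite addr0 add0r.
Qed.

Lemma vge_pexp c x k : vge c x -> vge (c * (p ^ k)%:R) (x ^+ (p ^ k)).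
Proof.
move=> cx i; rewrite hcoefX => h; rewrite -ler_pdivlMr ?pcharfP_gt0 //.
by apply: cx; apply: contraNneq h => ->; rewrite (pexp0 pK).
Qed.

End Frobenius.

(** * Roots of additive polynomials *)

Section Roots.
Variables (K : closedFieldType) (p : nat).
Hypothesis pK : p \in [pchar K].
Implicit Types x y z : hseries K.

Let pp : prime p := pcharf_prime pK.

(** Divide the additive polynomial by the variable. The exponents [p^i - 1] stay distinct, so the
    quotient is not constant and has a root, which is nonzero because the constant term is 1. *)
Lemma residue_root d (c : nat -> K) : c 0%N = 1 ->
  (exists2 j, (0 < j <= d)%N & c j != 0) ->
  exists2 r : K, r != 0 & \sum_(i < d.+1) c i * r ^+ (p ^ i) = 0.
Proof.
move=> c0 [j /andP[j0 jd] cj].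
have pk0 i : (0 < p ^ i)%N by rewrite expn_gt0 prime_gt0.
pose Q : {poly K} := \sum_(i < d.+1) c i *: 'X^((p ^ i).-1).
have inj i k : ((p ^ i).-1 == (p ^ k).-1) = (i == k).
  by rewrite -(inj_eq succn_inj) !prednK // eqn_exp2l // prime_gt1.
have coefQ k : (k <= d)%N -> Q`_((p ^ k).-1) = c k.
  move=> kd; have kd' : (k < d.+1)%N by [].
  rewrite coef_sum (bigD1 (Ordinal kd')) //= coefZ coefXn eqxx mulr1.
  rewrite big1 ?addr0 // => i ik; rewrite coefZ coefXn inj.
  by rewrite -[k]/(val (Ordinal kd')) (inj_eq val_inj) eq_sym (negPf ik) mulr0.
have [|r rr] := @closed_rootP K Q _.
  apply/negP => /size_poly1P[e e0 eQ]; move: cj; rewrite -coefQ // eQ coefC.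
  by have := inj j 0%N; rewrite expn0 /= (gtn_eqF j0) => ->; rewrite eqxx.
exists r.
  apply: contraTneq rr => ->; rewrite rootE horner_coef0.
  by have := coefQ 0%N; rewrite expn0 /= => ->; rewrite // c0 oner_neq0.
move: rr; rewrite rootE horner_sum => /eqP /(congr1 ( *%R r)); rewrite mulr0 mulr_sumr.
move=> e; rewrite -[RHS]e; apply: eq_bigr => i _.
by rewrite hornerZ hornerXn mulrCA -exprS prednK.
Qed.

(** The derivative of an additive polynomial is its coefficient [alpha 0 = 1], so every residue root
    is simple. By additivity the correction [e] of the constant lift [Z] satisfies exactly
    [e = R + S e], where [S] collects the terms of degree at least [p]. Since [e] has positive
    valuation, the residue [r] survives and the root is nonzero. *)
Lemma hensel_additive d (alpha : nat -> hseries K) :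
  (forall i, (i < d.+1)%N -> isP (alpha i)) ->
  (forall i, (i < d.+1)%N -> vge 0 (alpha i)) -> alpha 0%N = 1 ->
  (exists2 j, (0 < j <= d)%N & alpha j 0 != 0) ->
  exists z, [/\ isP z, z != 0 & \sum_(i < d.+1) alpha i * z ^+ (p ^ i) = 0].
Proof.
move=> /common_puis[a a0 aP] al0 al1 alj.
have ra : 0 < a%:R^-1 :> rat by rewrite invr_gt0 ltr0n.
have [|r r0 rE] := @residue_root d (fun i => alpha i 0) _ alj.
  by rewrite al1 hcoef1 eqxx.
pose Z := mono r 0.
have Zpow i : Z ^+ (p ^ i) = mono (r ^+ (p ^ i)) 0 by rewrite monoX mul0rn.
have aZ : puis a Z by apply: puis_mono; rewrite mulr0 rpred0.
pose R := - \sum_(i < d.+1) alpha i * Z ^+ (p ^ i).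
have aR : puis a R.
  by apply/puisN/puis_sum => i _; apply: puisM; [exact: aP | exact: puisX].
have R0 : vge (a%:R^-1) R.
  apply: vge_pos => //.
    apply/vgeN/vge_sum => i _; rewrite -[0]addr0; apply: vgeM; first exact: al0.
    by rewrite Zpow; exact: vge_mono.
  rewrite hcoefN hcoef_sum; under eq_bigr => i _.
    rewrite Zpow mulrC hcoef_monoM subr0 mulrC; over.
  by rewrite rE oppr0.
pose S e := - \sum_(i < d) alpha i.+1 * e ^+ (p ^ i.+1).
have [|x c cx ax xc|e [ae ce eE]] := @contraction _ a a%:R^-1 R S a0 aR R0.
- move=> x y; rewrite /S -opprD; congr (- _); rewrite -sumrN -big_split /=.
  by apply: eq_bigr => i _; rewrite (pexpB (pcharH pK)) mulrBr.
- split.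
    apply/puisN/puis_sum => i _; apply: puisM; last exact: puisX.
    by apply: aP; exact: (ltn_ord i).
  apply/vgeN/vge_sum => i _; rewrite -[_ + _]add0r; apply: vgeM.
    by apply: al0; exact: (ltn_ord i).
  apply: vge_le (vge_pexp pK (k := i.+1) xc).
  (* The power multiplies the valuation [c] by at least 2, and [c >= 1/a], whence the gain of
     [1/a]. *)
  have : 2%:R <= (p ^ i.+1)%:R :> rat.
    rewrite ler_nat expnS; apply: leq_trans (prime_gt1 pp) _.
    by rewrite leq_pmulr // expn_gt0 prime_gt0.
  have c0 : 0 < c by exact: lt_le_trans cx.
  by rewrite -(ler_pM2l c0); apply: le_trans; rewrite mulr_natr mulr2n lerD2l.
exists (Z + e); split.
- by exists a => //; exact: puisD.
- apply: contra_neq r0 => /(congr1 (fun x : hseries K => x 0)).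
  rewrite hcoefD hcoef_mono eqxx hcoef0 => <-.
  have [->|/ce] := eqVneq (e 0) 0; first by rewrite addr0.
  by rewrite leNgt ra.
- under eq_bigr => i _ do rewrite (pexpD (pcharH pK)) mulrDr.
  rewrite big_split /= -[X in X + _]opprK -/R [X in - R + X]big_ord_recl.
  rewrite al1 mul1r expr1 -[X in _ + (_ + X)]opprK -/(S e) {1}eE; ring.
Qed.

(** At [slope i] the terms of index 0 and [i] have equal valuation. Substituting [t^s z] with the
    largest slope [s] and dividing by [alpha 0 * t^s] leaves coefficients [beta i] of valuation at
    least 0, with [beta 0 = 1] and a nonzero residue at the index [j] where the maximum is attained:
    the situation of [hensel_additive]. *)
Lemma additive_root d (alpha : nat -> hseries K) : (0 < d)%N ->
  (forall i, (i < d.+1)%N -> isP (alpha i)) -> alpha 0%N != 0 -> alpha d != 0 ->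
  exists z, [/\ isP z, z != 0 & \sum_(i < d.+1) alpha i * z ^+ (p ^ i) = 0].
Proof.
move=> d0 alP al0 ald.
have lead i : {v : rat | alpha i != 0 -> alpha i v != 0 /\ vge v (alpha i)}.
  apply: cid; have [->|/hseries_lead[v h1 h2]] := eqVneq (alpha i) 0.
    by exists 0.
  by exists v.
pose v i := sval (lead i).
have vP i : alpha i != 0 -> alpha i (v i) != 0 /\ vge (v i) (alpha i).
  exact: (svalP (lead i)).
have [v01 v02] := vP _ al0.
have [a a0 aP] := alP _ (ltn0Sn d).
have [u [au uv uE]] := puis_inv_lead a0 aP v01 v02.
have u1 : u (- v 0%N) != 0.
  have := hcoefM_lead uv v02; rewrite uE addNr hcoef1 eqxx => e.
  by apply: contra_eq_neq e => ->; rewrite mul0r oner_neq0.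
have pi1 i : (0 < i)%N -> 0 < (p ^ i)%:R - 1 :> rat.
  move=> i0; rewrite subr_gt0 -[1]/(1%:R) ltr_nat.
  by rewrite -(expn0 p) ltn_exp2l // prime_gt1.
pose slope i : rat := (v 0%N - v i) / ((p ^ i)%:R - 1).
have P0 : (0 < val (@ord_max d))%N && (alpha (@ord_max d) != 0) by rewrite d0 ald.
case: (@arg_maxP _ _ _ _ (fun i : 'I_d.+1 => (0 < val i)%N && (alpha i != 0))
  (fun i : 'I_d.+1 => slope i) P0) => j /andP[j0 alj] jmax.
set s := slope j in jmax.
pose beta i := (u * mono 1 (- s)) * (alpha i * mono 1 (s * (p ^ i)%:R)).
have lead1 : vge (- v 0%N + - s) (u * mono 1 (- s)).
  by apply: vgeM => //; exact: vge_mono.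
have lead2 i : alpha i != 0 ->
    vge (v i + s * (p ^ i)%:R) (alpha i * mono 1 (s * (p ^ i)%:R)).
  by move=> /vP[_ h]; apply: vgeM => //; exact: vge_mono.
have [||||z [Pz nz ez]] := @hensel_additive d beta.
- move=> i id; apply: isPM; apply: isPM; try exact: isP_mono; last exact: alP.
  by exists a.
- move=> i id; have [e|ali] := eqVneq (alpha i) 0.
    by rewrite /beta e mul0r mulr0; exact: vge0.
  apply: vge_le (vgeM lead1 (lead2 i ali)).
  case: (posnP i) => [->|i0]; first by rewrite expn0 mulr1; lra.
  have := jmax (Ordinal id); rewrite /= i0 ali => /(_ isT).
  rewrite /= {1}/slope ler_pdivrMr ?pi1 // => h.
  by rewrite mulrBr mulr1 in h; lra.
- rewrite /beta expn0 mulr1 mulrACA uE mul1r monoM mulr1 addNr; exact: mono1.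
- exists (val j); first by rewrite j0 -ltnS ltn_ord.
  have e0 : 0 = (- v 0%N + - s) + (v j + s * (p ^ j)%:R).
    have : s * ((p ^ j)%:R - 1) = v 0%N - v j by rewrite /s /slope divfK ?gt_eqF ?pi1.
    by rewrite mulrBr mulr1 => h; lra.
  rewrite e0 (hcoefM_lead lead1 (lead2 j alj)).
  have [h1 h2] := vP _ alj.
  rewrite (hcoefM_lead uv (vge_mono (c := 1) (s := - s))).
  rewrite (hcoefM_lead h2 (vge_mono (c := 1) (s := s * (p ^ j)%:R))).
  by rewrite !hcoef_mono !eqxx !mulr1 mulf_neq0.
exists (mono 1 s * z); split.
- by apply: isPM => //; exact: isP_mono.
- apply: contra_neq nz => /(congr1 ( *%R (mono 1 (- s)))).
  by rewrite mulrA monoM addNr mulr1 mono1 mul1r mulr0.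
- have -> : \sum_(i < d.+1) alpha i * (mono 1 s * z) ^+ (p ^ i) =
      (alpha 0%N * mono 1 s) * \sum_(i < d.+1) beta i * z ^+ (p ^ i).
    rewrite mulr_sumr; apply: eq_bigr => i _.
    rewrite exprMn monoX expr1n -mulr_natr /beta.
    have e1 : (alpha 0%N * mono 1 s) * (u * mono 1 (- s)) = 1.
      by rewrite mulrACA [alpha _ * u]mulrC uE mul1r monoM subrr mulr1 mono1.
    by rewrite -[LHS]mul1r -e1; ring.
  by rewrite ez mulr0.
Qed.

End Roots.

(** * The field of Laurent series *)

Section Laurent.
Variable K : fieldType.

Definition lpred : {pred hseries K} := fun x => `[< puis 1 x >].

Lemma lpredP (x : hseries K) : reflect (puis 1 x) (x \in lpred).
Proof. exact: asboolP. Qed.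

Lemma lpred_subring : subring_closed lpred.
Proof.
split=> [|x y /lpredP hx /lpredP hy|x y /lpredP hx /lpredP hy]; apply/lpredP.
- exact: puis1.
- exact: puisB.
- exact: puisM.
Qed.

HB.instance Definition _ := GRing.isSubringClosed.Build (hseries K) lpred lpred_subring.

(** Packaging [K((t))] as a field gives access to kernels of matrices and to division of polynomials
    over it. *)
Record lseries := LSeries { lval :> hseries K; _ : lval \in lpred }.
HB.instance Definition _ := [isSub for lval].
HB.instance Definition _ := [Choice of lseries by <:].
HB.instance Definition _ := [SubChoice_isSubComNzRing of lseries by <:].

Lemma lseries_inv_ex (x : lseries) :
  exists y : lseries, (x != 0 -> y * x = 1) /\ (x = 0 -> y = 0).
Proof.
have [->|nx] := eqVneq x 0; first by exists 0.
have [y py e] := @puis_inv K 1 (lval x) isT (lpredP _ (valP x)) nx.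
exists (LSeries (introT (lpredP y) py)); split=> [_|x0]; first exact: val_inj.
by move: nx; rewrite x0 eqxx.
Qed.

Definition linv (x : lseries) : lseries := sval (cid (lseries_inv_ex x)).

Lemma lmulVf (x : lseries) : x != 0 -> linv x * x = 1.
Proof. exact: (svalP (cid (lseries_inv_ex x))).1. Qed.
Lemma linv0 : linv 0 = 0.
Proof. exact: (svalP (cid (lseries_inv_ex 0))).2. Qed.

HB.instance Definition _ := GRing.ComNzRing_isField.Build lseries lmulVf linv0.

Lemma laurentP (f : lseries) : laurent f.
Proof.
split=> [|i fi]; first exact: hseriesP.
by have := lpredP _ (valP f) i fi; rewrite mul1r.
Qed.

Lemma lseries_ex (f : rat -> K) : laurent f -> exists g : lseries, hcoef g = f.
Proof.
case=> hf fi; have h : mkH hf \in lpred by apply/lpredP => i /fi; rewrite mul1r.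
by exists (LSeries h).
Qed.

End Laurent.

(** * Finite-dimensional families of fractional parts *)

Section Span.
Variable K : fieldType.

Definition spanf (J : finType) (b : J -> rat -> K) (v : rat -> K) : Prop :=
  exists c : J -> K, forall q, v q = \sum_j c j * b j q.

Definition fdim (I : Type) (Y : I -> rat -> K) : Prop :=
  exists (J : finType) (b : J -> rat -> K), forall i, spanf b (Y i).

Section Ops.
Variables (J : finType) (b : J -> rat -> K).

Lemma spanf_ext v w : (forall q, v q = w q) -> spanf b w -> spanf b v.
Proof. by move=> vw [c cP]; exists c => q; rewrite vw. Qed.

Lemma spanf0 : spanf b (fun _ => 0).
Proof. by exists (fun _ => 0) => q; rewrite big1 // => j _; rewrite mul0r. Qed.

Lemma spanfD v w : spanf b v -> spanf b w -> spanf b (fun q => v q + w q).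
Proof.
move=> [c cP] [d dP]; exists (fun j => c j + d j) => q.
by rewrite cP dP -big_split; apply: eq_bigr => j _; rewrite mulrDl.
Qed.

Lemma spanfZ e v : spanf b v -> spanf b (fun q => e * v q).
Proof.
move=> [c cP]; exists (fun j => e * c j) => q.
by rewrite cP mulr_sumr; apply: eq_bigr => j _; rewrite mulrA.
Qed.

Lemma spanf_gen j : spanf b (b j).
Proof.
exists (fun k => (k == j)%:R) => q; rewrite (bigD1 j) //= eqxx mul1r big1 ?addr0 //.
by move=> k /negPf ->; rewrite mul0r.
Qed.

Lemma spanf_sum (T : eqType) (s : seq T) (F : T -> rat -> K) :
  (forall t, t \in s -> spanf b (F t)) -> spanf b (fun q => \sum_(t <- s) F t q).
Proof.
elim: s => [|t s IH] H.
  by apply: spanf_ext spanf0 => q; rewrite big_nil.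
apply: (@spanf_ext _ (fun q => F t q + \sum_(t <- s) F t q)).
  by move=> q; rewrite big_cons.
apply: spanfD; first by apply: H; rewrite mem_head.
by apply: IH => u us; apply: H; rewrite inE us orbT.
Qed.

Lemma spanf_trans (J' : finType) (b' : J' -> rat -> K) v :
  (forall j', spanf b (b' j')) -> spanf b' v -> spanf b v.
Proof.
move=> bb' [c cP]; apply: spanf_ext cP _.
by apply: spanf_sum => j _; apply: spanfZ.
Qed.

End Ops.

End Span.

Section Good.
Variables (K : closedFieldType) (p : nat).
Hypothesis pK : p \in [pchar K].
Let pp : prime p := pcharf_prime pK.
Let pH := pcharH pK.
Implicit Types x y z u g : hseries K.

(** This is the [p^k]-th power read on coefficients. It is stated for bare functions so that
    goodness applies to fractional parts and dilations without packaging them as [hseries]. *)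
Definition frobk (k : nat) (x : rat -> K) : rat -> K :=
  fun i => x (i / (p ^ k)%:R) ^+ (p ^ k).

Lemma hcoefXk x k : hcoef (x ^+ (p ^ k)) = frobk k x.
Proof. by apply/funext => i; rewrite (hcoefX pK). Qed.

Definition fracfam (x : rat -> K) (nk : int * nat) : rat -> K :=
  yser (frobk nk.2 x) nk.1.

Lemma fracfamE x nk : fracfam x nk = yser (x ^+ (p ^ nk.2)) nk.1.
Proof. by rewrite hcoefXk. Qed.

Definition good (x : rat -> K) : Prop := fdim (fracfam x).

Lemma good0 : good (0 : hseries K).
Proof.
exists void, (fun _ _ => 0) => -[n k]; apply: spanf_ext (spanf0 _) => q.
by rewrite fracfamE (pexp0 pH) /yser if_same.
Qed.

(** Powers of [z] keep the denominator [a]. A term at [m] shifts exponents by [-m = Q + r/a]: the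
    integer [Q] only changes the index of the fractional part, and the shift by [r/a] cuts it in two
    according to the carry. The pairs (residue, carry) are finite in number, independently of [n]
    and [k]. *)
Lemma good_puis_mul z x : isP z -> good x -> good (z * x).
Proof.
case=> a a0 az [J [b bP]]; have ra : 0 < a%:R :> rat by rewrite ltr0n.
pose b' (t : 'I_a * bool * J) : rat -> K := fun i =>
  let i' := (val t.1.1)%:R / a%:R + i - (t.1.2 : nat)%:R in
  if (0 <= i) && (i < 1) && ((0 <= i') && (i' < 1)) then b t.2 i' else 0.
exists ('I_a * bool * J)%type, b' => -[n k]; rewrite fracfamE exprMn.
set f := z ^+ _; set h := x ^+ _.
have af : puis a f by exact: puisX.
have [c1 fc] : exists c1 : rat, _ := hahn_bounded (hseriesP (x := f)).
have [c2 hc] : exists c2 : rat, _ := hahn_bounded (hseriesP (x := h)).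
pose B := Num.bound `|a%:R * c1|; pose N := Num.bound `|a%:R * (n%:~R + 1 - c2) + B%:R|.
have Bc : - B%:R < a%:R * c1.
  by rewrite ltrNl; apply: le_lt_trans (ler_norm _) _; rewrite normrN; apply: archi_boundP.
have Nc : a%:R * (n%:~R + 1 - c2) + B%:R < N%:R.
  by apply: le_lt_trans (ler_norm _) _; apply: archi_boundP.
(* The multiples of [1/a] allowed by the lower bounds [c1] of [f] and [c2] of [h]: only these [m]
   can contribute at an exponent below [n + 1]. *)
pose s := [seq (l%:R - B%:R) / a%:R : rat | l <- iota 0 N].
pose w (m : rat) : rat -> K := fun i => if (0 <= i) && (i < 1) then h (n%:~R + i - m) else 0.
apply: (@spanf_ext _ _ _ _ (fun i => \sum_(m <- s) f m * w m i)).
  move=> i; rewrite /yser /w; case: ifP => [/andP[i0 i1]|_]; last first.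
    by rewrite big1 // => m _; rewrite mulr0.
  rewrite hcoefM (hmulE (s := s)) //.
    rewrite map_inj_uniq ?iota_uniq // => l1 l2.
    by move/(mulIf (invr_neq0 (lt0r_neq0 ra)))/addIr/eqP; rewrite eqr_nat => /eqP.
  move=> m fm hm; have /intrP[l el] := af _ fm.
  have h1 : - B%:R < a%:R * m.
    by apply: lt_le_trans Bc _; rewrite ler_pM2l // fc.
  have h2 : a%:R * m + B%:R < N%:R.
    apply: lt_trans Nc; rewrite ltrD2r ltr_pM2l //; have := hc _ hm; lra.
  have : exists l' : nat, a%:R * m + B%:R = l'%:R.
    by apply/natrP; rewrite natrEint rpredD ?af ?rpred_nat //=; lra.
  case=> l' el'; apply/mapP; exists l'.
    by rewrite mem_iota /= add0n -(ltr_nat rat) -el'.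
  by rewrite -el' addrK mulrC mulKf ?gt_eqF.
apply: spanf_sum => m /mapP[l0 _ em]; apply: spanfZ.
have [l el] : exists l : int, - (a%:R * m) = l%:~R.
  exists (Posz B - Posz l0); rewrite em mulrC divfK ?gt_eqF // opprB.
  by rewrite rmorphB.
have ea : (a : int) != 0 by rewrite -lt0n.
have rlt : (`|(l %% a)%Z| < a)%N.
  by rewrite -ltz_nat gez0_abs ?modz_ge0 // ltz_pmod.
pose r := Ordinal rlt; pose Q : int := (l %/ a)%Z.
have emr : - m = Q%:~R + (val r)%:R / a%:R.
  have e1 : - m = l%:~R / a%:R by rewrite -el -mulrN mulrC mulKf ?gt_eqF.
  rewrite e1 {1}(divz_eq l a) rmorphD rmorphM /= mulrDl mulfK ?gt_eqF //.
  by rewrite -[(`|_|%N)%:R]/((Posz `|(l %% a)%Z|%N)%:~R) gez0_abs ?modz_ge0.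
(* The Boolean [c] is the carry in [r/a + i]. *)
pose part (c : bool) : rat -> K := fun i =>
  let i' := (val r)%:R / a%:R + i - (c : nat)%:R in
  if (0 <= i) && (i < 1) && ((0 <= i') && (i' < 1))
  then yser h (n + Q + (c : nat)) i' else 0.
have rP : (0 <= (val r)%:R / a%:R :> rat) /\ ((val r)%:R / a%:R < 1 :> rat).
  by split; [rewrite divr_ge0 | rewrite ltr_pdivrMr // mul1r ltr_nat].
apply: (@spanf_ext _ _ _ _ (fun i => part false i + part true i)).
  move=> i; rewrite /w /part /yser /=; case: ifP => [/andP[i0 i1]|_] /=; last by rewrite addr0.
  have -> : n%:~R + i - m = (n + Q)%:~R + ((val r)%:R / a%:R + i).
    by rewrite rmorphD /= emr; ring.
  move: rP; set R := _ / _ => -[R0 R1].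
  rewrite !subr0; have [lt1|ge1] := ltP (R + i) 1.
    rewrite addr_ge0 //=; have -> : (0 <= R + i - 1) = false by apply/negbTE; rewrite -ltNge; lra.
    by rewrite addr0.
  rewrite andbF add0r; have -> : (0 <= R + i - 1 < 1) by apply/andP; split; lra.
  by congr (h _); rewrite [in RHS]rmorphD /=; ring.
have partP c : spanf b' (part c).
  have := bP (n + Q + (c : nat), k)%R; rewrite fracfamE => -[e eP].
  apply: (@spanf_ext _ _ _ _ (fun q => \sum_j e j * b' (r, c, j) q)).
    move=> q; rewrite /part /b' /=; case: ifP => [_|_]; first exact: eP.
    by rewrite big1 // => j _; rewrite mulr0.
  by apply: spanf_sum => j _; apply: spanfZ; exact: spanf_gen.
exact: spanfD.
Qed.

Lemma frob_telescope u g k : u ^+ p - u = g ->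
  u ^+ (p ^ k) = u + \sum_(j < k) g ^+ (p ^ j).
Proof.
move=> e; elim: k => [|k IH]; first by rewrite big_ord0 addr0 expr1.
rewrite big_ord_recr /= addrA -IH -e (pexpB pH) -exprM -expnS.
by rewrite addrC subrK.
Qed.

(* Writing [u = u^(p^k) - sum_(j < k) g^(p^j)], the first term has no exponent in a
   given bounded interval of positive numbers once [k] is large. *)
Lemma good_artin_schreier u g : u ^+ p - u = g -> good g -> good u.
Proof.
move=> e [J [b bP]].
have [c uc] := hahn_bounded (hseriesP (x := u)); pose C := Num.bound `|c|.
have uC i : u i != 0 -> - C%:R < i.
  move=> /uc; apply: lt_le_trans; rewrite ltrNl; apply: le_lt_trans (ler_norm _) _.
  by rewrite normrN; apply: archi_boundP.
(* Generators: those of [g], the constant 1 for the coefficient at exponent 0, and the finitely many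
   fractional parts of [u] with negative index that can be nonzero. *)
pose b' (t : J + unit + 'I_C) : rat -> K := match t with
  | inl (inl j) => b j | inl (inr _) => hmono 1 0 | inr l => yser u (- (l.+1)%:Z) end.
have gP n k : spanf b' (yser (g ^+ (p ^ k)) n).
  have := bP (n, k); rewrite fracfamE; apply: spanf_trans => j.
  exact: (spanf_gen b' (inl (inl j))).
have yD v w (n : int) q : yser (v + w : hseries K) n q = yser v n q + yser w n q.
  by rewrite /yser; case: ifP; rewrite ?addr0.
have ysum n k : spanf b' (yser (\sum_(j < k) g ^+ (p ^ j)) n).
  apply: (@spanf_ext _ _ _ _ (fun q => \sum_(j <- index_enum 'I_k) yser (g ^+ (p ^ j)) n q)).
    move=> q; rewrite /yser; case: ifP => _; first by rewrite hcoef_sum.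
    by rewrite big1.
  by apply: spanf_sum.
have uP n : spanf b' (yser u n).
  have [n0|n0] := ltP n 0.
    have [nC|nC] := ltP n (- C%:Z).
      apply: spanf_ext (spanf0 _) => q; rewrite /yser; case: ifP => // /andP[q0 q1].
      apply: contrapT => /eqP /uC; apply/negP; rewrite -leNgt.
      have : (n + 1)%:~R <= (- C%:Z)%:~R :> rat by rewrite ler_int; lia.
      by rewrite rmorphD rmorphN /= => h; lra.
    have nlt : (`|n|.-1 < C)%N by lia.
    have -> : n = - ((Ordinal nlt).+1)%:Z by rewrite /=; lia.
    exact: (spanf_gen b' (inr (Ordinal nlt))).
  have [k kP] : exists k, forall q, 0 <= q < 1 -> 0 < n%:~R + q ->
      u ((n%:~R + q) / (p ^ k)%:R) = 0.
    have [[i0 [ui0 i00]]|nou] := pselect (exists i, u i != 0 /\ 0 < i); last first.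
      exists 0%N => q _ q0; apply: contrapT => /eqP uq; apply: nou.
      by eexists; split; first exact: uq; rewrite expn0 divr1.
    have [||eps [ueps eps0] epsP] := hseriesP (x := u) (A := [set i | u i != 0 /\ 0 < i]).
    - by move=> ? [].
    - by exists i0.
    pose k := Num.bound `|(n%:~R + 1) / eps|; exists k => q /andP[q0 q1] nq.
    have pk : 0 < (p ^ k)%:R :> rat by exact: pcharfP_gt0.
    apply: contrapT => /eqP uq; have := epsP _ (conj uq _).
    rewrite divr_gt0 // => /(_ isT); apply/negP; rewrite -ltNge.
    rewrite ltr_pdivrMr //; apply: (@lt_trans _ _ (n%:~R + 1)); first by rewrite ltrD2l.
    rewrite -ltr_pdivrMl // mulrC; apply: (@lt_trans _ _ k%:R).
      by apply: le_lt_trans (ler_norm _) _; apply: archi_boundP.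
    by rewrite ltr_nat ltn_expl // prime_gt1.
  apply: (@spanf_ext _ _ _ _ (fun q => yser (u ^+ (p ^ k)) n q +
     (- 1) * yser (\sum_(j < k) g ^+ (p ^ j)) n q)).
    by move=> q; rewrite (frob_telescope k e) yD mulN1r addrK.
  apply: spanfD; last exact: spanfZ.
  (* By the choice of [k] every positive exponent [n + q] has been pushed below the least positive
     exponent of [u], so only [q = 0] can survive. *)
  apply: (@spanf_ext _ _ _ _ (fun q => yser (u ^+ (p ^ k)) n 0 * hmono 1 0 q)).
    move=> q; rewrite /hmono; case: (eqVneq q 0) => [->|q0]; first by rewrite mulr1.
    rewrite mulr0 /yser; case: ifP => // /andP[q0' q1].
    rewrite (hcoefX pK) kP ?(pexp0 pK) //; first by rewrite q0'.
    by rewrite ltr_wpDl ?ler0z // lt_neqAle eq_sym q0.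
  by apply: spanfZ; exact: (spanf_gen b' (inl (inr tt))).
exists (J + unit + 'I_C)%type, b' => -[n k]; rewrite fracfamE.
apply: (@spanf_ext _ _ _ _ (fun q => yser u n q +
     yser (\sum_(j < k) g ^+ (p ^ j)) n q)).
  by move=> q; rewrite (frob_telescope k e) yD.
exact: spanfD.
Qed.

(** Denominators divide [a p^k] with [a] fixed and [k] free: after dilation by [a] the exponents lie
    in [Z[1/p]]. *)
Definition zsupp (a : nat) (x : rat -> K) : Prop :=
  forall i, x i != 0 -> exists k, a%:R * i * (p ^ k)%:R \is a Num.int.

Definition nice x : Prop := good x /\ exists2 a, (0 < a)%N & zsupp a x.

Lemma nice_puis_mul z x : isP z -> nice x -> nice (z * x).
Proof.
move=> Pz [gx [a a0 ax]]; split; first exact: good_puis_mul.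
case: Pz => b b0 bz; exists (a * b)%N; first by rewrite muln_gt0 a0.
move=> i /hcoefM_neq0[j [l [/bz jb /ax[k lk] ->]]]; exists k.
have -> : (a * b)%:R * (j + l) * (p ^ k)%:R =
  (a * p ^ k)%:R * (b%:R * j) + b%:R * (a%:R * l * (p ^ k)%:R) :> rat.
  by rewrite !natrM; ring.
by rewrite rpredD // rpredM // ?rpred_nat // intr_nat.
Qed.

(** At an exponent [j] violating [zsupp] the series [g] vanishes, so [u_(j/p)^p = u_j]: the
    violating part of the support is stable under multiplication and division by [p]. Multiplication
    gives an infinite descent among negative exponents, division among positive ones, against
    well-ordering. *)
Lemma nice_artin_schreier u g : u ^+ p - u = g -> nice g -> nice u.
Proof.
move=> e [gg [a a0 ag]]; split; first exact: good_artin_schreier e gg.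
exists a => // i ui; apply: contrapT => bad0.
pose bad (i : rat) := ~ exists k, a%:R * i * (p ^ k)%:R \is a Num.int.
have pr : 1 < p%:R :> rat by rewrite ltr1n prime_gt1.
have p0 : 0 < p%:R :> rat by exact: lt_trans pr.
have badM j : bad j -> bad (j * p%:R).
  move=> bj [k jk]; apply: bj; exists k.+1; rewrite expnS natrM.
  by rewrite (_ : _ * _ = a%:R * (j * p%:R) * (p ^ k)%:R) //; ring.
have badV j : bad j -> bad (j / p%:R).
  move=> bj [k jk]; apply: bj; exists k.
  rewrite (_ : _ * _ = (a%:R * (j / p%:R) * (p ^ k)%:R) * p%:R).
    by rewrite rpredM // intr_nat.
  by field; rewrite gt_eqF.
have step j : bad j -> u (j / p%:R) ^+ p = u j.
  move=> bj; have := hcoefX pK u 1 j; rewrite !expn1 => <-.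
  have -> : u ^+ p = u + g by rewrite -e addrC subrK.
  rewrite hcoefD; have [->|/ag //] := eqVneq (g j) 0; first by rewrite addr0.
have [i0|i0|i0] := ltgtP i 0.
- have [||m [um [m0 bm]] mmin] := hseriesP (x := u)
    (A := [set j | u j != 0 /\ j < 0 /\ bad j]); [by move=> ? []|by exists i|].
  have := mmin (m * p%:R); rewrite /= -(step _ (badM _ bm)) mulfK ?gt_eqF //.
  rewrite expf_neq0 // pmulr_llt0 // => /(_ (conj isT (conj m0 (badM _ bm)))).
  by apply/negP; rewrite -ltNge -subr_gt0 -[X in X - _]mulr1 -mulrBr nmulr_rgt0 // subr_lt0.
- have [||m [um [m0 bm]] mmin] := hseriesP (x := u)
    (A := [set j | u j != 0 /\ 0 < j /\ bad j]); [by move=> ? []|by exists i|].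
  have um' : u (m / p%:R) != 0.
    by apply: contra_neq um => h; rewrite -(step _ bm) h -[p]expn1 (pexp0 pK).
  have := mmin (m / p%:R); rewrite /= um' divr_gt0 // => /(_ (conj isT (conj isT (badV _ bm)))).
  by apply/negP; rewrite -ltNge ltr_pdivrMr // ltr_pMr.
- by apply: bad0; exists 0%N; rewrite i0 mulr0 mul0r.
Qed.

Lemma frobinvK (c : K) : frobinv p c ^+ p = c.
Proof.
have : frobinv p c ^+ p.-1.+1 = c by apply/eqP; exact: (xchooseP (root_exists p.-1 c)).
by rewrite prednK // prime_gt0.
Qed.

(** Puiseux series form a perfect field here: take roots of the coefficients and divide exponents by
    [p], which turns the denominator [a] into [a p]. *)
Lemma pth_root y : isP y -> exists2 y', isP y' & y' ^+ p = y.
Proof.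
case=> a a0 ay; have p0 : 0 < p%:R :> rat by rewrite ltr0n prime_gt0.
have nz i : frobinv p (y (i * p%:R)) != 0 -> y (i * p%:R) != 0.
  by apply: contra_neq => h; have := frobinvK (y (i * p%:R)); rewrite h => /eqP;
    rewrite expf_eq0 => /andP[_ /eqP].
have hy : hahn (fun i => frobinv p (y (i * p%:R))).
  move=> A AS [i0 Ai0].
  have [||m Am mmin] := hseriesP (x := y) (A := [set j | A (j / p%:R)]).
  - by move=> j /AS /= /nz; rewrite divfK ?gt_eqF.
  - by exists (i0 * p%:R); rewrite /= mulfK ?gt_eqF.
  exists (m / p%:R) => // i Ai; rewrite ler_pdivrMr //; apply: mmin.
  by rewrite /= mulfK ?gt_eqF.
exists (mkH hy).
  exists (a * p)%N => [|i /nz /ay]; first by rewrite muln_gt0 a0 prime_gt0.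
  by rewrite natrM -mulrA [p%:R * _]mulrC.
apply: hseries_eq => i; have := hcoefX pK (mkH hy) 1 i; rewrite !expn1 => ->.
by rewrite /= divfK ?gt_eqF // frobinvK.
Qed.

Lemma frob_reduced y : y ^+ p = 0 -> y = 0.
Proof.
move=> e; apply: hseries_eq => i; have := hcoefX pK y 1 (i * p%:R).
rewrite !expn1 e hcoef0 mulfK ?pnatr_eq0 -?lt0n ?prime_gt0 // => /esym/eqP.
by rewrite expf_eq0 => /andP[_ /eqP].
Qed.

(** Abel summation. For [U i = u^(p^i)] the differences are [(u^p - u)^(p^j)], so a relation for [u]
    whose coefficients sum to 0 becomes one for [u^p - u] with one term fewer. *)
Lemma summation_by_parts (R : comNzRingType) (A U : nat -> R) d :
  \sum_(i < d.+1) A i * U i = (\sum_(i < d.+1) A i) * U d -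
    \sum_(j < d) (\sum_(i < j.+1) A i) * (U j.+1 - U j).
Proof.
elim: d => [|d IH]; first by rewrite !big_ord1 big_ord0 subr0.
have -> : \sum_(i < d.+2) A i * U i =
    \sum_(i < d.+1) A i * U i + A d.+1 * U d.+1 by rewrite big_ord_recr.
have -> : \sum_(i < d.+2) A i = \sum_(i < d.+1) A i + A d.+1 by rewrite big_ord_recr.
have -> : \sum_(j < d.+1) (\sum_(i < j.+1) A i) * (U j.+1 - U j) =
    \sum_(j < d) (\sum_(i < j.+1) A i) * (U j.+1 - U j) +
    (\sum_(i < d.+1) A i) * (U d.+1 - U d) by rewrite big_ord_recr.
rewrite IH; ring.
Qed.

Lemma additive_relation_nice d (A : nat -> hseries K) x :
  (forall i, (i < d.+1)%N -> isP (A i)) -> A d != 0 ->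
  \sum_(i < d.+1) A i * x ^+ (p ^ i) = 0 -> nice x.
Proof.
elim: d A x => [|d IH] A x PA Ad e.
  have [y _ yA] := isP_inv (PA 0%N isT) Ad.
  have -> : x = 0.
    by move: e; rewrite big_ord1 expr1 => /(congr1 ( *%R y)); rewrite mulrA yA mul1r mulr0.
  by split; [exact: good0 | exists 1%N => // i; rewrite hcoef0 eqxx].
(* Without the term of index 0 the relation is a [p]-th power; its [p]-th root has smaller
   degree. *)
have [A0|A0] := eqVneq (A 0%N) 0.
  have rt i : {y : hseries K | (i < d.+1)%N -> isP y /\ y ^+ p = A i.+1}.
    apply: cid; have [id|] := boolP (i < d.+1)%N; last by exists 0.
    by have [y Py ey] := pth_root (PA i.+1 id); exists y.
  apply: (IH (fun i => sval (rt i))).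
  - by move=> i id; case: (svalP (rt i) id).
  - apply: contra_neq Ad => h; case: (svalP (rt d) (ltnSn d)) => _ <-.
    by rewrite h -[p]expn1 (pexp0 pH).
  - apply: frob_reduced; have := pexp_sum pH 1; rewrite expn1 => ->.
    rewrite -[RHS]e [RHS]big_ord_recl A0 mul0r add0r.
    apply: eq_bigr => i _; rewrite exprMn -exprM -expnSr.
    by case: (svalP (rt i) (ltn_ord i)) => _ ->.
have [z [Pz z0 ez]] := additive_root pK (ltn0Sn d) PA A0 Ad.
have [w Pw wz] := isP_inv Pz z0.
have [u exu] : exists u, x = z * u.
  by exists (w * x); rewrite mulrA [z * w]mulrC wz mul1r.
rewrite exu; apply: nice_puis_mul => //.
apply: (@nice_artin_schreier _ (u ^+ p - u)) => //.
pose B i := A i * z ^+ (p ^ i).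
have PB i : (i < d.+2)%N -> isP (B i) by move=> id; apply: isPM; [exact: PA | exact: isPX].
have eB : \sum_(i < d.+2) B i * u ^+ (p ^ i) = 0.
  by rewrite -[RHS]e; apply: eq_bigr => i _; rewrite /B exu exprMn mulrA.
apply: (IH (fun j => \sum_(i < j.+1) B i)).
- move=> i id; apply: isP_sum => j; apply: PB; apply: leq_trans (ltn_ord j) _.
  exact: ltnW.
(* That [z] is a root says that all [B i] sum to 0, so the new leading coefficient is [- B d.+1],
   which is nonzero. *)
- have : \sum_(i < d.+2) B i = 0 by exact: ez.
  rewrite big_ord_recr /= => /eqP; rewrite addr_eq0 => /eqP ->; rewrite oppr_eq0.
  apply: contra_neq Ad => h; have : B d.+1 * w ^+ (p ^ d.+1) = 0 by rewrite h mul0r.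
  by rewrite /B -mulrA -exprMn [z * w]mulrC wz expr1n mulr1.
- move: eB; rewrite (summation_by_parts B (fun i => u ^+ (p ^ i))).
  rewrite [X in X * _]ez mul0r sub0r => /eqP; rewrite oppr_eq0 => /eqP eB.
  rewrite -[RHS]eB; apply: eq_bigr => j _; rewrite (pexpB pH) -exprM -expnS.
  by [].
Qed.

End Good.

(** * From finite-dimensional families to automata *)

Section Generators.
Variable K : fieldType.

(** Take as many members as possible with independent coordinate vectors. Generators must belong to
    the family itself, because the digit operators are only known to map members to members. *)
Lemma fdim_generators (I : Type) (Y : I -> rat -> K) : fdim Y ->
  exists d (g : 'I_d -> I), forall i, spanf (fun j => Y (g j)) (Y i).
Proof.
case=> J [b bP].
have Cex i : {v : 'rV[K]_#|J| | forall q, Y i q = \sum_l v 0 l * b (enum_val l) q}.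
  apply: cid; have [c cP] := bP i; exists (\row_l c (enum_val l)) => q.
  by rewrite cP (reindex_onto enum_val enum_rank) /= => [|j _]; rewrite ?enum_rankK //;
    apply: eq_big => [l|l _]; rewrite ?enum_valK ?eqxx ?mxE.
pose C i := sval (Cex i); have CP i q : Y i q = \sum_l C i 0 l * b (enum_val l) q.
  exact: (svalP (Cex i)).
pose M r (g : 'I_r -> I) := \matrix_(j < r) C (g j).
pose P r := `[< exists g : 'I_r -> I, row_free (M r g) >].
have P0 : exists r, P r.
  exists 0%N; apply/asboolP; exists (fun j : 'I_0 => match j with Ordinal _ h => False_rect _ (notF h) end).
  by rewrite /row_free -leqn0 rank_leq_row.
have Pub r : P r -> (r <= #|J|)%N.
  by move=> /asboolP[g /eqP <-]; exact: rank_leq_col.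
case: (ex_maxnP P0 Pub) => r /asboolP[g gfree] rmax; exists r, g => i.
have [/submxP[D eD]|nsub] := boolP (C i <= M r g)%MS.
  exists (fun j => D 0 j) => q; rewrite CP eD.
  under eq_bigr => l _ do rewrite mxE mulr_suml.
  rewrite exchange_big /=; apply: eq_bigr => j _.
  by rewrite CP mulr_sumr; apply: eq_bigr => l _; rewrite mxE mulrA.
suff : P r.+1 by move/rmax; rewrite ltnn.
apply/asboolP; pose g' (j : 'I_(1 + r)) := match split j with inl _ => i | inr k => g k end.
exists g'.
have -> : M r.+1 g' = col_mx (C i) (M r g).
  apply/row_matrixP => j; rewrite rowK; apply/rowP => l; rewrite !mxE /g'.
  by case: (@split 1 r j) => k; rewrite ?mxE // ord1.
rewrite /row_free eqn_leq rank_leq_row /=.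
move: gfree; rewrite /row_free => /eqP {1}<-.
have <- : \rank (C i + M r g)%MS = \rank (col_mx (C i) (M r g)).
  exact: (addsmxE (C i) (M r g)).1.
apply: rank_ltmx; rewrite /ltmx addsmxSr /=.
by apply: contra nsub => h; apply: submx_trans h; exact: addsmxSl.
Qed.

End Generators.

Section DigitWords.
Variable p : nat.
Implicit Types s w : seq 'I_p.

Definition ival s : nat := foldl (fun acc (d : 'I_p) => acc * p + d)%N 0%N s.

Lemma ival_rcons s d : ival (rcons s d) = (ival s * p + d)%N.
Proof. by rewrite /ival -cats1 foldl_cat. Qed.

Lemma intvalE s : intval s = (ival s)%:R.
Proof.
elim/last_ind: s => [//|s d IH].
by rewrite ival_rcons /intval -cats1 foldl_cat /= -/(intval s) IH natrD natrM.
Qed.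

Lemma fracval_itv s : (0 <= fracval s) && (fracval s < 1).
Proof.
elim: s => [|d s /andP[h0 h1]] /=; first by [].
have p0 : 0 < p%:R :> rat by rewrite ltr0n; case: (p) d => [[]|].
apply/andP; split; first by rewrite divr_ge0 ?addr_ge0.
rewrite ltr_pdivrMr // mul1r.
have : d.+1%:R <= p%:R :> rat by rewrite ler_nat.
by rewrite -natr1 => h; lra.
Qed.

(** A crude bound, but it turns a bound on the integer part into a bound on the number of Frobenius
    twists. *)
Lemma L0_size s : (1 < p)%N -> L0 s -> (size s <= ival s)%N.
Proof.
move=> p1; elim/last_ind: s => [//|s d IH].
rewrite ival_rcons size_rcons; case: s IH => [|e s] IH h.
  by move: h => /=; lia.
have := IH h; have -> : size (e :: s) = (size s).+1 by [].
by nia.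
Qed.

Lemma composed_cat (K : fieldType) m (tau : 'I_p -> 'rV[K]_m -> 'rV[K]_m) s w :
  composed tau (s ++ w) = composed tau s \o composed tau w.
Proof. by elim: s => [|d s IH] //=; rewrite IH. Qed.

End DigitWords.

Section FrobInv.
Variables (K : closedFieldType) (p : nat).
Hypothesis pK : p \in [pchar K].

Lemma frob_inj : injective (fun c : K => c ^+ p).
Proof.
move=> c d /= e; apply/eqP; rewrite -subr_eq0.
have := pexpB pK 1 c d; rewrite expn1 e subrr => /eqP.
by rewrite expf_eq0 => /andP[].
Qed.

Lemma frobinvD (c d : K) : frobinv p (c + d) = frobinv p c + frobinv p d.
Proof.
apply: frob_inj => /=; have := pexpD pK 1 (frobinv p c) (frobinv p d).
by rewrite expn1 => ->; rewrite !(frobinvK pK).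
Qed.
Lemma frobinvM (c d : K) : frobinv p (c * d) = frobinv p c * frobinv p d.
Proof. by apply: frob_inj => /=; rewrite exprMn !(frobinvK pK). Qed.
Lemma frobinv0 : frobinv p (0 : K) = 0.
Proof. by apply: (addrI (frobinv p 0)); rewrite -frobinvD !addr0. Qed.

Definition frobinvn r : K -> K := iter r (frobinv p).

Lemma frobinvnD r (c d : K) : frobinvn r (c + d) = frobinvn r c + frobinvn r d.
Proof. by elim: r => [//|r IH] /=; rewrite -frobinvD -IH. Qed.
Lemma frobinvnM r (c d : K) : frobinvn r (c * d) = frobinvn r c * frobinvn r d.
Proof. by elim: r => [//|r IH] /=; rewrite -frobinvM -IH. Qed.
Lemma frobinvn0 r : frobinvn r 0 = 0.
Proof. by elim: r => [//|r IH] /=; rewrite IH frobinv0. Qed.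
Lemma frobinvn_sum r (J : finType) (F : J -> K) :
  frobinvn r (\sum_j F j) = \sum_j frobinvn r (F j).
Proof. by apply: (big_morph _ (frobinvnD r) (frobinvn0 r)). Qed.
Lemma frobinvnS r (c : K) : frobinvn r (frobinv p c) = frobinv p (frobinvn r c).
Proof. by rewrite /frobinvn -iterSr. Qed.
Lemma frobinvnK r (c : K) : frobinvn r c ^+ (p ^ r) = c.
Proof.
elim: r => [|r IH]; first by rewrite expr1.
by rewrite expnS exprM /= (frobinvK pK) IH.
Qed.

End FrobInv.

(** * The automaton of a finite digit-reading system *)

Section Build.
Variables (K : closedFieldType) (p : nat).
Hypothesis pK : p \in [pchar K].
Let pp : prime p := pcharf_prime pK.

Variables (J : finType) (beta : J -> rat -> K) (M : 'I_p -> J -> J -> K).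
Variables (a : nat) (c : nat -> J -> K).
(** Prepending the fractional digit [b] acts on the vector of values of [beta] by a matrix followed
    by the inverse Frobenius, that is, by an inverse-Frobenius-semilinear map. The map [tau2] is
    this action, with [M] twisted [r] times at level [r]. *)
Hypothesis betaE : forall (b : 'I_p) j i, 0 <= i < 1 ->
  beta j (((val b)%:R + i) / p%:R) ^+ p = \sum_l M b j l * beta l i.

(* A state [(r, m, j)] carries [beta_j] of the fractional part, twisted by the inverse
   Frobenius [r] times; [m] is the integer read so far.  Each integer digit decreases
   [r], so that the components with [r = 0] are untwisted once all digits are read.
   The two boolean states make [iota] injective and [pi] surjective. *)
Let T := ('I_a.+1 * 'I_a * J + bool)%type.

Let get (v : 'rV[K]_#|{: T}|) (t : T) : K := v 0 (enum_rank t).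
Let mk (F : T -> K) : 'rV[K]_#|{: T}| := \row_i F (enum_val i).

Let getmk F t : get (mk F) t = F t.
Proof. by rewrite /get /mk mxE enum_rankK. Qed.
Let getD u v t : get (u + v) t = get u t + get v t. Proof. by rewrite /get mxE. Qed.
Let getZ r v t : get (r *: v) t = r * get v t. Proof. by rewrite /get mxE. Qed.
Let get_ext u v : (forall t, get u t = get v t) -> u = v.
Proof. by move=> h; apply/rowP => i; have := h (enum_val i); rewrite /get enum_valK. Qed.

Let divp_lt (m : 'I_a) : (m %/ p < a)%N.
Proof. exact: leq_ltn_trans (leq_div m p) (ltn_ord m). Qed.

(** Written backwards: before the last integer digit [d] was read, the integer was [m %/ p] and the
    level [r + 1]; the [p]-th power removes one inverse Frobenius. The test [r < a] keeps [inord]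
    within range. *)
Let tau1 (d : 'I_p) (v : 'rV[K]_#|{: T}|) := mk (fun t => match t with
  | inl (r, m, j) => if (m %% p == d)%N && (r < a)%N
                     then get v (inl (inord r.+1, Ordinal (divp_lt m), j)) ^+ p else 0
  | inr _ => 0 end).

Let tau2 (b : 'I_p) (v : 'rV[K]_#|{: T}|) := mk (fun t => match t with
  | inl (r, m, j) => frobinv p (\sum_l frobinvn p r (M b j l) * get v (inl (r, m, l)))
  | inr _ => 0 end).

Let iota (k : K) := mk (fun t => match t with
  | inl (r, m, j) => if val m == 0%N then k * frobinvn p r (beta j 0) else 0
  | inr e => if e then k else 0 end).

Let out (v : 'rV[K]_#|{: T}|) : K :=
  \sum_(m < a) \sum_j c m j * get v (inl (ord0, m, j)) + get v (inr false).

Let tau1_semilinear d : Defs.semilinear (frob p) (tau1 d).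
Proof.
split=> [u v|r v]; apply: get_ext => -[[[s m] j]|e];
  rewrite ?getD ?getZ !getmk ?addr0 ?mulr0 //.
  case: ifP; rewrite ?addr0 // getD => _.
  by have := pexpD pK 1 (get u (inl (inord s.+1, Ordinal (divp_lt m), j)))
    (get v (inl (inord s.+1, Ordinal (divp_lt m), j))); rewrite expn1.
by case: ifP; rewrite ?mulr0 // getZ exprMn.
Qed.

Let tau2_semilinear b : Defs.semilinear (frobinv p) (tau2 b).
Proof.
split=> [u v|r v]; apply: get_ext => -[[[s m] j]|e];
  rewrite ?getD ?getZ !getmk ?addr0 ?mulr0 //.
  rewrite -(frobinvD pK) -big_split; congr (frobinv _ _).
  by apply: eq_bigr => l _; rewrite getD mulrDr.
rewrite -(frobinvM pK) mulr_sumr; congr (frobinv _ _).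
by apply: eq_bigr => l _; rewrite getZ mulrCA.
Qed.



Let frobinvX (k : K) : frobinv p (k ^+ p) = k.
Proof. by apply: (frob_inj pK) => /=; rewrite (frobinvK pK). Qed.

Let state2 s2 r m j : get (composed tau2 s2 (iota 1)) (inl (r, m, j)) =
  if val m == 0%N then frobinvn p r (beta j (fracval s2)) else 0.
Proof.
elim: s2 r m j => [|b s2 IH] r m j; first by rewrite getmk mul1r.
rewrite [LHS]getmk; under eq_bigr => l _ do rewrite IH.
case: ifP => _; last first.
  by rewrite big1 ?(frobinv0 pK) // => l _; rewrite mulr0.
under eq_bigr => l _ do rewrite -(frobinvnM pK).
rewrite -(frobinvn_sum pK) -betaE; last exact: fracval_itv.
by rewrite -frobinvnS frobinvX.
Qed.

Let state2_false s2 : get (composed tau2 s2 (iota 1)) (inr false) = 0.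
Proof. by case: s2 => [|b s2]; rewrite [LHS]getmk. Qed.

(** A component at level [r] started at level [r + size s1], which must not exceed the top level
    [a]; otherwise it has been lost. *)
Let state1 s1 s2 r m j :
  get (composed tau1 (rev s1) (composed tau2 s2 (iota 1))) (inl (r, m, j)) =
  if (val m == ival s1) && (r + size s1 <= a)%N
  then frobinvn p r (beta j (fracval s2)) else 0.
Proof.
elim/last_ind: s1 r m j => [|s1 d IH] r m j.
  by rewrite state2 addn0 -ltnS ltn_ord andbT.
rewrite rev_rcons [LHS]getmk ival_rcons size_rcons.
have p0 : (0 < p)%N by exact: prime_gt0.
have -> : (val m == ival s1 * p + d)%N = ((m %% p == d) && (m %/ p == ival s1))%N.
  apply/eqP/andP => [->|[/eqP e1 /eqP e2]].
    by rewrite modnMDl modn_small // divnMDl // divn_small // addn0 !eqxx.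
  by have := divn_eq m p; rewrite e1 e2.
case: (m %% p == d)%N => //=; case: ltnP => ra; last first.
  by rewrite ifF //; apply/negbTE; rewrite negb_and -ltnNge; apply/orP; right; lia.
rewrite IH inordK // addSnnS; case: ifP => _; first by rewrite /= (frobinvK pK).
by rewrite expr0n gtn_eqF.
Qed.

Let state1_false s1 s2 :
  get (composed tau1 (rev s1) (composed tau2 s2 (iota 1))) (inr false) = 0.
Proof.
case/lastP: s1 => [|s1 d]; first exact: state2_false.
by rewrite rev_rcons [LHS]getmk.
Qed.

Lemma automatic_of_system (z : rat -> K) :
  (forall i, z i != 0 -> zpnonneg p i) ->
  (forall m i, 0 <= i < 1 ->
     z (m%:R + i) = if (m < a)%N then \sum_j c m j * beta j i else 0) ->
  automatic p z.
Proof.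
move=> zsup zE; split=> //.
exists (fun s1 s2 k => out (composed tau1 (rev s1) (composed tau2 s2 (iota k)))); split.
  exists #|{: T}|, iota, out, (composed tau1), (composed tau2); split.
    move=> r u v; apply: get_ext => -[[[s m] j]|e]; rewrite getD getZ !getmk.
      by case: ifP => _; rewrite ?mulr0 ?addr0 // mulrDl mulrA.
    by case: e; rewrite ?mulr0 ?addr0.
  split.
    by move=> u v /(congr1 (fun w => get w (inr true))); rewrite !getmk.
  split.
    move=> r u v; rewrite /out getD getZ mulrDr addrACA; congr (_ + _).
    rewrite mulr_sumr -big_split; apply: eq_bigr => m _ /=.
    rewrite mulr_sumr -big_split; apply: eq_bigr => j _ /=.
    by rewrite getD getZ mulrDr mulrCA.
  split.
    move=> k; exists (mk (fun t => if t is inr false then k else 0)).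
    rewrite /out getmk big1 ?add0r // => m _; rewrite big1 // => j _.
    by rewrite getmk mulr0.
  split; first by exists tau1; split=> // d; exact: tau1_semilinear.
  by split=> //; exists tau2; split=> // b; exact: tau2_semilinear.
move=> s1 s2 /andP[L1 L2].
rewrite /numval intvalE zE ?fracval_itv // /out state1_false addr0.
under [RHS]eq_bigr => m _.
  under eq_bigr => j _ do rewrite state1 add0n.
  over.
case: ltnP => h; last first.
  apply/esym; rewrite big1 // => m _; rewrite big1 // => j _.
  by rewrite ltn_eqF ?mulr0 //; exact: leq_trans (ltn_ord m) h.
(* Here [a] bounds the integer part, and hence also the number of levels needed to reach level 0. *)
have sz : (size s1 <= a)%N.
  by apply: leq_trans (ltnW h); apply: L0_size; rewrite // prime_gt1.
rewrite [RHS](bigD1 (Ordinal h)) //= eqxx sz [X in _ + X]big1 ?addr0 //= => m ne.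
rewrite big1 // => j _; rewrite ifF ?mulr0 //; apply/negbTE; rewrite negb_and.
by move: ne; rewrite -val_eqE /= => ->.
Qed.

End Build.

Section NiceQuasi.
Variables (K : closedFieldType) (p : nat).
Hypothesis pK : p \in [pchar K].
Let pp : prime p := pcharf_prime pK.
Let p0 : 0 < p%:R :> rat. Proof. by rewrite ltr0n prime_gt0. Qed.

Lemma frobk0 (x : rat -> K) : frobk p 0 x = x.
Proof. by apply/funext => i; rewrite /frobk expn0 divr1 expr1. Qed.

Lemma frobkS k (x : rat -> K) i : frobk p k.+1 x i = frobk p k x (i / p%:R) ^+ p.
Proof.
rewrite /frobk expnSr exprM natrM; congr (x _ ^+ _ ^+ _).
by rewrite invfM mulrA mulrAC.
Qed.

Definition dilate (a : nat) (x : rat -> K) : rat -> K := fun i => x (i / a%:R).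

(** Write [n = Q a + r]; then [(n + q) / a = Q + (r + q) / a], so each fractional part of the
    dilation is one of the [a] pieces of a fractional part of [x], stretched. *)
Lemma good_dilate a (x : rat -> K) : (0 < a)%N -> good p x -> good p (dilate a x).
Proof.
move=> a0 [J [b bP]]; have ra : 0 < a%:R :> rat by rewrite ltr0n.
pose b' (t : 'I_a * J) : rat -> K := fun i =>
  if (0 <= i) && (i < 1) then b t.2 (((val t.1)%:R + i) / a%:R) else 0.
exists ('I_a * J)%type, b' => -[n k].
have ea : (a : int) != 0 by rewrite -lt0n.
have rlt : (`|(n %% a)%Z| < a)%N.
  by rewrite -ltz_nat gez0_abs ?modz_ge0 // ltz_pmod.
pose r := Ordinal rlt; pose Q : int := (n %/ a)%Z.
have en : n%:~R = Q%:~R * a%:R + (val r)%:R :> rat.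
  rewrite {1}(divz_eq n a) rmorphD rmorphM /=; congr (_ + _).
  by rewrite -[(`|_|%N)%:R]/((Posz `|(n %% a)%Z|%N)%:~R) gez0_abs ?modz_ge0.
have [e eP] := bP (Q, k).
apply: (@spanf_ext _ _ _ _ (fun q => \sum_j e j * b' (r, j) q)).
  move=> q; rewrite /fracfam /yser /b' /=; case: ifP => [/andP[q0 q1]|_]; last first.
    by rewrite big1 // => j _; rewrite mulr0.
  have := eP (((val r)%:R + q) / a%:R); rewrite /fracfam /yser /= ifT.
    move=> <-; rewrite /frobk /dilate; congr (x _ ^+ _).
    by rewrite en; field; rewrite !lt0r_neq0 ?pcharfP_gt0.
  apply/andP; split; first by apply: divr_ge0; [apply: addr_ge0 | ].
  rewrite ltr_pdivrMr // mul1r.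
  have : (val r).+1%:R <= a%:R :> rat by rewrite ler_nat.
  by apply: lt_le_trans; rewrite -natr1 ltrD2l.
by apply: spanf_sum => j _; apply: spanfZ; exact: spanf_gen.
Qed.

Lemma zpnonneg_of_int i k : 0 <= i -> i * (p ^ k)%:R \is a Num.int -> zpnonneg p i.
Proof.
move=> i0 ik; have pk := pcharfP_gt0 k pp.
have /natrP[n en] : i * (p ^ k)%:R \is a Num.nat.
  by rewrite natrEint ik mulr_ge0 // ltW.
by exists n, k; rewrite -en mulfK // gt_eqF.
Qed.

(** Dilation by [a] with [b = 0] places [y_n] on [[0, a)], and its piece over [[m, m + 1)] is the
    fractional part of index [a n + m] of the dilated [x]. Generators of these fractional parts
    serve as [beta]. *)
Lemma nice_quasi (x : hseries K) (n : int) : nice p x -> quasi_automatic p (yser x n).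
Proof.
move=> [gx [a a0 ax]]; have ra : 0 < a%:R :> rat by rewrite ltr0n.
have sup j : yser x n j != 0 -> zpnonneg p (a%:R * j).
  rewrite /yser; case: ifP; rewrite ?eqxx // => /andP[j0 j1] /ax[k hk].
  apply: (@zpnonneg_of_int _ k); first by rewrite mulr_ge0 // ltW.
  have -> : a%:R * j * (p ^ k)%:R =
      a%:R * (n%:~R + j) * (p ^ k)%:R - (a * p ^ k)%:R * n%:~R :> rat.
    by rewrite natrM; ring.
  by rewrite rpredB // rpredM ?intr_int // intr_nat.
exists a, 0%N; split=> //; split.
  move=> j /sup h; exists (a%:R * j); split=> //.
  by rewrite subr0 mulrC mulKf // gt_eqF.
have [d [g gP]] := fdim_generators (good_dilate a0 gx).
pose beta (j : 'I_d) := fracfam p (dilate a x) (g j).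
(* The index comes from [(n + (b + i)/p) / p^k = (p n + b + i) / p^(k+1)]. *)
have Mex (b : 'I_p) j : {M : 'I_d -> K | forall i,
    fracfam p (dilate a x) (p%:Z * (g j).1 + (val b)%:Z, (g j).2.+1) i =
    \sum_l M l * beta l i}.
  by apply: cid; apply: gP.
have cex (m : nat) : {c : 'I_d -> K | forall i,
    fracfam p (dilate a x) (a%:Z * n + m%:Z, 0%N) i = \sum_l c l * beta l i}.
  by apply: cid; apply: gP.
apply: (@automatic_of_system _ _ pK _ beta (fun b j => sval (Mex b j)) a
  (fun m => sval (cex m))).
- move=> b j i /andP[i0 i1]; rewrite -(svalP (Mex b j)) /beta /fracfam /yser /= i0 i1 /=.
  have -> : 0 <= ((val b)%:R + i) / p%:R < (1 : rat).
    rewrite divr_ge0 ?addr_ge0 //= ltr_pdivrMr // mul1r.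
    have : (val b).+1%:R <= p%:R :> rat by rewrite ler_nat; exact: ltn_ord.
    by apply: lt_le_trans; rewrite -natr1 ltrD2l.
  rewrite frobkS; congr (frobk _ _ _ _ ^+ _).
  by rewrite rmorphD rmorphM /=; field; rewrite gt_eqF.
- by move=> i /sup; rewrite subr0 mulrC divfK // gt_eqF.
- move=> m i /andP[i0 i1]; rewrite -(svalP (cex m)) /fracfam /yser /= frobk0 i0 i1 /=.
  rewrite subr0 divr_ge0 ?addr_ge0 // ?ltW //= ltr_pdivrMr // mul1r.
  have -> : (m%:R + i < a%:R) = (m < a)%N.
    apply/idP/idP => h.
      by rewrite -(ltr_nat rat); apply: le_lt_trans h; rewrite lerDl.
    have : m.+1%:R <= a%:R :> rat by rewrite ler_nat.
    by apply: lt_le_trans; rewrite -natr1 ltrD2l.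
  case: ifP => // _; rewrite /dilate; congr (hcoef x _).
  by rewrite rmorphD rmorphM /=; field; rewrite gt_eqF.
Qed.

Lemma good_fin_span (x : rat -> K) : good p x -> fin_span (yser x).
Proof.
case=> J [b bP]; exists #|J|, (fun l => b (enum_val l)) => n.
have [c cP] := bP (n, 0%N); exists (fun l => c (enum_val l)) => i.
have := cP i; rewrite /fracfam /= frobk0 => ->.
rewrite (reindex_onto enum_val enum_rank) /= => [|j _]; last by rewrite enum_rankK.
by apply: eq_bigl => l; rewrite enum_valK eqxx.
Qed.

End NiceQuasi.

(** * From automata to finite-dimensional families *)

Section Expansions.
Variable p : nat.
Hypothesis pp : prime p.
Let p0 : 0 < p%:R :> rat. Proof. by rewrite ltr0n prime_gt0. Qed.

Lemma ival_ex (N : nat) : exists s : seq 'I_p, L0 s /\ ival s = N.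
Proof.
elim/ltn_ind: N => N IH; case: (posnP N) => [->|N0]; first by exists [::].
have [s [Ls es]] := IH _ (ltn_Pdiv (prime_gt1 pp) N0).
exists (rcons s (Ordinal (ltn_pmod N (prime_gt0 pp)))); split; last first.
  by rewrite ival_rcons es -divn_eq.
case: s Ls es => [|d s] //= _ e; apply: contraTneq N0 => h.
by rewrite (divn_eq N p) h -e.
Qed.

(** The word has exactly [k] digits, zeros included, since its length governs the twist and the
    position of the digits that follow. *)
Lemma fracval_ex (k M : nat) : (M < p ^ k)%N ->
  exists w : seq 'I_p, size w = k /\ fracval w = M%:R / (p ^ k)%:R.
Proof.
elim: k M => [|k IH] M Mk.
  by exists [::]; move: Mk; rewrite expn0 ltnS leqn0 => /eqP ->; rewrite /= mul0r.
have pk : (0 < p ^ k)%N by rewrite expn_gt0 prime_gt0.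
have dlt : (M %/ p ^ k < p)%N by rewrite ltn_divLR // -expnS.
have [w [sw ew]] := IH _ (ltn_pmod M pk).
exists (Ordinal dlt :: w); split; first by rewrite /= sw.
rewrite /= ew [in RHS](divn_eq M (p ^ k)) natrD natrM expnS natrM.
by field; rewrite !lt0r_neq0 // ltr0n.
Qed.

Lemma fracval_cat (w s : seq 'I_p) :
  fracval (w ++ s) = fracval w + fracval s / (p ^ size w)%:R.
Proof.
elim: w => [|d w IH]; first by rewrite /= add0r divr1.
have pk := pcharfP_gt0 (size w) pp.
by rewrite /= IH expnS natrM; field; rewrite !lt0r_neq0.
Qed.

Lemma fracval_strip (w : seq 'I_p) : exists s : seq 'I_p, L0 (rev s) /\ fracval s = fracval w.
Proof.
elim/last_ind: w => [|w d [s [Ls es]]]; first by exists [::].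
have [d0|d0] := eqVneq (val d) 0%N; last by exists (rcons w d); rewrite rev_rcons.
exists s; split=> //; rewrite es -cats1 fracval_cat /= d0.
by rewrite addr0 !mul0r addr0.
Qed.

Lemma fracval_of_zp i : zpnonneg p i -> i < 1 ->
  exists s : seq 'I_p, L0 (rev s) /\ fracval s = i.
Proof.
case=> n [k ->]; have pk := pcharfP_gt0 k pp.
rewrite ltr_pdivrMr // mul1r ltr_nat => nk.
by have [w [_ ew]] := fracval_ex nk; have [s [Ls es]] := fracval_strip w;
  exists s; rewrite es ew.
Qed.

End Expansions.

Section SemilinearWords.
Variables (K : fieldType) (p m : nat) (psi : K -> K).
Variable tau : 'I_p -> 'rV[K]_m -> 'rV[K]_m.
Hypothesis tauP : forall a, Defs.semilinear psi (tau a).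

Lemma composedD s u v : composed tau s (u + v) = composed tau s u + composed tau s v.
Proof. by elim: s => [//|d s IH] /=; rewrite IH (proj1 (tauP d)). Qed.

Lemma composedZ s r v : composed tau s (r *: v) = iter (size s) psi r *: composed tau s v.
Proof. by elim: s => [//|d s IH] /=; rewrite IH (proj2 (tauP d)). Qed.

End SemilinearWords.

Section QuasiGood.
Variables (K : closedFieldType) (p : nat).
Hypothesis pK : p \in [pchar K].
Let pp : prime p := pcharf_prime pK.

Lemma iter_frob n (r : K) : iter n (frob p) r = r ^+ (p ^ n).
Proof. by elim: n => [|n IH]; rewrite ?expr1 // iterS IH /frob -exprM -expnSr. Qed.

Lemma zpnonneg_ge0 i : zpnonneg p i -> 0 <= i.
Proof. by case=> n [k ->]; rewrite divr_ge0. Qed.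

(** The exponent [(N + i) / p^k] is spelled by the digits [s1] of [N %/ p^k], then [k] digits [w2]
    of [N %% p^k], then the digits of [i]. The inverse twists of [w2] cancel the [p^k]-th power,
    leaving a combination of the [p^(size s1)]-th powers of the entries of [vec i], with
    [size s1 <= C]. *)
Lemma automatic_good (z : rat -> K) (C : nat) :
  automatic p z -> (forall i, z i != 0 -> i < C%:R) -> good p z.
Proof.
case=> zsup [f [[m [iota [pi [f1 [f2 [_ [_ [piP [_ [[tau1 [t1 e1]] [[tau2 [t2 e2]] fE]]]]]]]]]]] zf]] zC.
(* The expansion chosen for a fractional part is irrelevant: prepending digits to it
   gives one word for each exponent, which is all that is used. *)
pose digits (i : rat) : seq 'I_p :=
  if pselect (exists s : seq 'I_p, L0 (rev s) /\ fracval s = i) is left h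
  then sval (cid h) else [::].
pose ok (i : rat) := `[< exists s : seq 'I_p, L0 (rev s) /\ fracval s = i >].
have okP i : ok i -> L0 (rev (digits i)) /\ fracval (digits i) = i.
  by move/asboolP; rewrite /digits; case: pselect => // h _; exact: (svalP (cid h)).
pose vec (i : rat) := composed tau2 (digits i) (iota 1).
(* The exponent 0 gets its own generator: with no digits after [w2], the word could end in 0 and
   fall outside [Lp]. *)
pose b (t : unit + 'I_C.+1 * 'I_m) : rat -> K := match t with
  | inl _ => hmono 1 0
  | inr (l, j) => fun i => if (0 < i) && (i < 1) && ok i then vec i 0 j ^+ (p ^ l) else 0 end.
exists (unit + 'I_C.+1 * 'I_m)%type, b => -[n k]; set w := fracfam _ _ _.
have pk : (0 < p ^ k)%N by rewrite expn_gt0 prime_gt0.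
have pkr : 0 < (p ^ k)%:R :> rat by rewrite ltr0n.
have wE i : 0 < i -> i < 1 -> w i = z ((n%:~R + i) / (p ^ k)%:R) ^+ (p ^ k).
  by move=> i0 i1; rewrite /w /fracfam /yser /= ltW // i1.
have w_out i : ~~ ((0 <= i) && (i < 1)) -> w i = 0.
  by rewrite /w /fracfam /yser => /negbTE ->.
suff [c cP] : exists c : 'I_C.+1 * 'I_m -> K, forall i, 0 < i -> i < 1 ->
    w i = \sum_t c t * b (inr t) i.
  apply: (@spanf_ext _ _ _ _ (fun i => w 0 * hmono 1 0 i + \sum_t c t * b (inr t) i)).
    move=> i; rewrite /hmono; case: (eqVneq i 0) => [->|i0].
      by rewrite mulr1 big1 ?addr0 // => -[l j] _; rewrite /= mulr0.
    rewrite mulr0 add0r; have [/andP[h0 h1]|h] := boolP ((0 < i) && (i < 1)).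
      exact: cP.
    rewrite w_out ?big1 // => [[l j] _|]; first by rewrite /= (negPf h) mulr0.
    by apply: contra h => /andP[h0 ->]; rewrite lt_neqAle eq_sym i0 h0.
  apply: spanfD; first by apply: spanfZ; exact: (spanf_gen b (inl tt)).
  by apply: spanf_sum => t _; apply: spanfZ; exact: (spanf_gen b (inr t)).
have zero : (forall i, 0 < i -> i < 1 -> z ((n%:~R + i) / (p ^ k)%:R) = 0) ->
    exists c : 'I_C.+1 * 'I_m -> K, forall i, 0 < i -> i < 1 ->
    w i = \sum_t c t * b (inr t) i.
  move=> h; exists (fun _ => 0) => i i0 i1; rewrite wE // h // (pexp0 pK) big1 // => t _.
  by rewrite mul0r.
have [n0|n0] := ltP n 0.
  apply: zero => i i0 i1; apply: contrapT => /eqP /zsup /zpnonneg_ge0; apply/negP.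
  rewrite -ltNge pmulr_llt0 ?invr_gt0 //.
  have : (n + 1)%:~R <= (0 : int)%:~R :> rat by rewrite ler_int; lia.
  by rewrite rmorphD /= => h; lra.
case: n n0 @w wE w_out zero => // N _ w wE w_out zero.
have [s1 [L1 es1]] := ival_ex pp (N %/ p ^ k).
have [w2 [sw2 ew2]] := fracval_ex pp (ltn_pmod N pk).
have numE i : 0 < i -> ok i ->
    Lp s1 (w2 ++ digits i) /\ numval s1 (w2 ++ digits i) = (N%:R + i) / (p ^ k)%:R.
  move=> i0 /okP[Lr er]; split.
    rewrite /Lp L1 /= rev_cat; case: (digits i) Lr er => [_ e|d s].
      by move: i0; rewrite -e /= ltxx.
    by rewrite lastI rev_rcons.
  rewrite /numval intvalE es1 (fracval_cat pp) er sw2 ew2 [in RHS](divn_eq N (p ^ k)).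
  by rewrite natrD natrM; field; rewrite lt0r_neq0.
(* A longer [s1] forces the exponent to be at least [C], where [z] vanishes. *)
have [lC|Cl] := leqP (size s1) C; last first.
  apply: zero => i i0 i1; apply: contrapT => /eqP /zC; apply/negP; rewrite -leNgt.
  have h1 : (C <= N %/ p ^ k)%N.
    by rewrite -es1; apply: leq_trans (ltnW Cl) (L0_size (prime_gt1 pp) L1).
  rewrite ler_pdivlMr //; apply: (@le_trans _ _ N%:R).
    by rewrite -natrM ler_nat; apply: leq_trans (leq_trunc_div N (p ^ k)); rewrite leq_mul2r h1 orbT.
  by rewrite lerDl ltW.
pose G (v : 'rV[K]_m) := pi (composed tau1 (rev s1) (composed tau2 w2 v)).
have piD u v : pi (u + v) = pi u + pi v by have := piP 1 u v; rewrite scale1r mul1r.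
have pi00 : pi 0 = 0 by apply: (addrI (pi 0)); rewrite -piD !addr0.
have piZ r v : pi (r *: v) = r * pi v by have := piP r v 0; rewrite addr0 pi00 addr0.
have GD u v : G (u + v) = G u + G v.
  by rewrite /G (composedD t2) (composedD t1) piD.
have G0 : G 0 = 0 by apply: (addrI (G 0)); rewrite -GD !addr0.
(* Inside [G] the scalar undergoes [k] inverse Frobenius maps and [size s1] Frobenius maps; the
   outer power undoes the former. *)
have GZ r v : G (r *: v) ^+ (p ^ k) = r ^+ (p ^ size s1) * G v ^+ (p ^ k).
  rewrite /G (composedZ t2) (composedZ t1) piZ exprMn size_rev sw2; congr (_ * _).
  by rewrite iter_frob exprAC (frobinvnK pK).
have GE v : G v ^+ (p ^ k) =
    \sum_(j < m) G (delta_mx 0 j) ^+ (p ^ k) * v 0 j ^+ (p ^ size s1).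
  rewrite {1}(row_sum_delta v) (big_morph G GD G0) (pexp_sum pK).
  by apply: eq_bigr => j _; rewrite GZ mulrC.
exists (fun t => if val t.1 == size s1 then G (delta_mx 0 t.2) ^+ (p ^ k) else 0).
move=> i i0 i1; rewrite wE //.
have lC' : (size s1 < C.+1)%N by [].
have pairE (F : 'I_C.+1 * 'I_m -> K) : \sum_t F t = \sum_l \sum_j F (l, j).
  by rewrite pair_bigA; apply: eq_bigr => -[].
rewrite pairE /=.
rewrite (bigD1 (Ordinal lC')) //= eqxx [X in _ = _ + X]big1 ?addr0; last first.
  move=> l; rewrite -val_eqE /= => /negPf ->; rewrite big1 // => j _.
  by rewrite mul0r.
rewrite i0 i1 /=; case: (boolP (ok i)) => oki; last first.
  rewrite big1 => [|j _]; last by rewrite mulr0.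
  suff -> : z ((N%:~R + i) / (p ^ k)%:R) = 0 by rewrite (pexp0 pK).
  apply: contrapT => /eqP /zsup [M [k' eM]]; move: oki; rewrite /ok => /asboolP[].
  apply: (fracval_of_zp pp) => //; apply: (zpnonneg_of_int pK (k := k')); first exact: ltW.
  have pk' := pcharfP_gt0 k' pp.
  have -> : i * (p ^ k')%:R = M%:R * (p ^ k)%:R - N%:R * (p ^ k')%:R.
    have : (N%:R + i) = M%:R / (p ^ k')%:R * (p ^ k)%:R.
      by rewrite -eM divfK // lt0r_neq0.
    move=> /(congr1 (fun x => x - N%:R)); rewrite addrC addKr => ->.
    by field; rewrite lt0r_neq0.
  by rewrite rpredB // rpredM ?intr_nat.
have [Ls eN] := numE i i0 oki.
rewrite -[N%:~R]/(N%:R) -eN zf // fE // e1 e2 composed_cat /= -/(vec i).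
exact: GE.
Qed.

(** The interval [[0,1)] is cut into [a] pieces by the integer part [r] of [a i]. Under the [p^k]-th
    power the translation by [b] becomes the integer shift [b p^k], which only changes the index. *)
Lemma good_undilate (z : rat -> K) (a b : nat) : (0 < a)%N -> good p z ->
  good p (fun j => z (a%:R * j + b%:R)).
Proof.
move=> a0 [J [g gP]]; have ra : 0 < a%:R :> rat by rewrite ltr0n.
pose g' (t : 'I_a * J) : rat -> K := fun i =>
  let i' := a%:R * i - (val t.1)%:R in
  if (0 <= i) && (i < 1) && ((0 <= i') && (i' < 1)) then g t.2 i' else 0.
exists ('I_a * J)%type, g' => -[n k].
have pk := pcharfP_gt0 k pp.
pose part (r : 'I_a) : rat -> K := fun i =>
  let i' := a%:R * i - (val r)%:R in
  if (0 <= i) && (i < 1) && ((0 <= i') && (i' < 1))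
  then fracfam p z (a%:Z * n + (val r)%:Z + (b * p ^ k)%:Z, k) i' else 0.
apply: (@spanf_ext _ _ _ _ (fun i => \sum_(r <- index_enum 'I_a) part r i)); last first.
  apply: spanf_sum => r _.
  have [e eP] := gP (a%:Z * n + (val r)%:Z + (b * p ^ k)%:Z, k).
  apply: (@spanf_ext _ _ _ _ (fun q => \sum_j e j * g' (r, j) q)).
    move=> q; rewrite /part /g' /=; case: ifP => [_|_]; first exact: eP.
    by rewrite big1 // => j _; rewrite mulr0.
  by apply: spanf_sum => j _; apply: spanfZ; exact: spanf_gen.
move=> i; rewrite {1}/fracfam /yser /=; case: ifP => [/andP[i0 i1]|ni]; last first.
  by rewrite big1 // => r _; rewrite /part ni.
have ai0 : 0 <= a%:R * i by rewrite mulr_ge0.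
have [r er] : exists r : nat, r%:R <= a%:R * i < r.+1%:R.
  by have := truncn_itv ai0; exists (Num.truncn (a%:R * i)).
case/andP: er => er1 er2.
have rlt : (r < a)%N.
  rewrite -(ltr_nat rat); apply: le_lt_trans er1 _.
  by rewrite -[X in _ < X]mulr1 ltr_pM2l.
rewrite (bigD1 (Ordinal rlt)) //= [X in _ = _ + X]big1 ?addr0; last first.
  move=> s sr; rewrite /part ifF //; apply/negP => /andP[_ /andP[]].
  rewrite subr_ge0 ltrBlDr [1 + _]addrC natr1 => h1 h2.
  move: sr; rewrite -val_eqE /= => /eqP; apply.
  have := le_lt_trans er1 h2; have := le_lt_trans h1 er2.
  by rewrite !ltr_nat !ltnS => ? ?; apply/eqP; rewrite eqn_leq; apply/andP.
rewrite /part i0 i1 /= subr_ge0 er1 ltrBlDr [1 + _]addrC natr1 er2 /=.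
rewrite /fracfam /yser /= subr_ge0 er1 ltrBlDr [1 + _]addrC natr1 er2 /=.
rewrite /frobk; congr (z _ ^+ _).
have eb : ((b * p ^ k)%N : int)%:~R = b%:R * (p ^ k)%:R :> rat by rewrite -natrM.
by rewrite !rmorphD /= eb rmorphM /=; field; rewrite lt0r_neq0.
Qed.

Lemma quasi_good (x : rat -> K) (n : int) :
  quasi_automatic p (yser x n) -> good p (yser x n).
Proof.
case=> a [b [a0 [_ aut]]]; have ra : 0 < a%:R :> rat by rewrite ltr0n.
have gz : good p (fun i => yser x n ((i - b%:R) / a%:R)).
  (* Since [yser] vanishes from 1 on, [(i - b) / a < 1], hence [i < a + b]. *)
  apply: (automatic_good (C := (a + b)%N) aut) => i; rewrite {1}/yser.
  case: ifP; rewrite ?eqxx // => /andP[_]; rewrite ltr_pdivrMr // mul1r ltrBlDr.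
  by rewrite natrD.
have -> : yser x n = (fun j => yser x n ((a%:R * j + b%:R - b%:R) / a%:R)).
  by apply/funext => j; rewrite addrK mulrC mulKf // lt0r_neq0.
exact: good_undilate gz.
Qed.

(** With [n = q p^k + c] and [0 <= c < p^k], the fractional part of index [n] of the [p^k]-th power
    of [x] is that of index [c] of the [p^k]-th power of [y_q]. Finitely many [y_(g j)] span all
    [y_q], and Frobenius respects the combination. *)
Lemma good_of_yser (x : rat -> K) :
  (forall n, good p (yser x n)) -> fin_span (yser x) -> good p x.
Proof.
move=> yg [d0 [b0 b0P]].
have [d [g gP]] : exists d (g : 'I_d -> int), forall n,
    spanf (fun j => yser x (g j)) (yser x n).
  by apply: fdim_generators; exists 'I_d0, b0.
have Jex j : {J : finType & {b : J -> rat -> K |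
    forall i, spanf b (fracfam p (yser x (g j)) i)}}.
  by have /cid[J /cid[b bP]] := yg (g j); exists J, b.
pose J j := projT1 (Jex j); pose b j : J j -> rat -> K := sval (projT2 (Jex j)).
have bP j i : spanf (b j) (fracfam p (yser x (g j)) i) by exact: (svalP (projT2 (Jex j))).
exists {j : 'I_d & J j}, (fun t => b (tag t) (tagged t)) => -[n k].
have pk := pcharfP_gt0 k pp; have pkn : (0 < p ^ k)%N by rewrite expn_gt0 prime_gt0.
have ea : ((p ^ k)%N : int) != 0 by rewrite -lt0n.
pose q := (n %/ (p ^ k)%N)%Z; pose c := (n %% (p ^ k)%N)%Z.
have [e eP] := gP q.
apply: (@spanf_ext _ _ _ _ (fun i => \sum_(j <- index_enum 'I_d)
   e j ^+ (p ^ k) * fracfam p (yser x (g j)) (c, k) i)); last first.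
  apply: spanf_sum => j _; apply: spanfZ; have [u uP] := bP j (c, k).
  apply: spanf_ext uP _; apply: spanf_sum => t _; apply: spanfZ.
  exact: (spanf_gen (fun t : {j : 'I_d & J j} => b (tag t) (tagged t)) (Tagged J t)).
move=> i; rewrite {1}/fracfam /yser /=; case: ifP => [/andP[i0 i1]|ni]; last first.
  by rewrite big1 // => j _; rewrite /fracfam {1}/yser ni mulr0.
under eq_bigr => j _ do rewrite /fracfam {1}/yser /= i0 i1 /= /frobk -exprMn.
rewrite -(pexp_sum pK) -eP /frobk /yser.
have c0 : 0 <= c%:~R :> rat by rewrite ler0z modz_ge0.
have -> : (0 <= (c%:~R + i) / (p ^ k)%:R) && ((c%:~R + i) / (p ^ k)%:R < 1).
  rewrite divr_ge0 ?addr_ge0 //= ltr_pdivrMr // mul1r.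
  have : (c + 1)%:~R <= ((p ^ k)%N : int)%:~R :> rat.
    by rewrite ler_int; have := ltz_pmod n (d := (p ^ k)%N); rewrite /c; lia.
  by rewrite rmorphD /=; apply: lt_le_trans; rewrite ltrD2l.
congr (x _ ^+ _); rewrite {1}(divz_eq n (p ^ k)%N) rmorphD rmorphM /= -/q -/c.
by field; rewrite lt0r_neq0.
Qed.

End QuasiGood.

(** * Integrality and additive relations *)

Lemma left_kernel (F : fieldType) n (M : 'M[F]_(n.+1, n)) :
  exists2 v : 'rV_n.+1, v != 0 & v *m M = 0.
Proof.
have /rowV0Pn[v vM v0] : kermx M != 0.
  rewrite kermx_eq0 /row_free; apply: contraTneq (rank_leq_col M) => ->.
  by rewrite -ltnNge.
by exists v => //; apply/sub_kermxP.
Qed.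

Section Integral.
Variable K : fieldType.
Implicit Types (x : hseries K) (Q : {poly lseries K}).

Definition lev x Q : hseries K := (map_poly (val : lseries K -> hseries K) Q).[x].

Lemma lvalM (c d : lseries K) : val (c * d) = val c * val d.
Proof. exact: rmorphM. Qed.

Lemma levD x Q R : lev x (Q + R) = lev x Q + lev x R.
Proof. by rewrite /lev rmorphD hornerD. Qed.
Lemma levM x Q R : lev x (Q * R) = lev x Q * lev x R.
Proof. by rewrite /lev rmorphM hornerM. Qed.
Lemma lev_sum x (I : Type) (r : seq I) (F : I -> {poly lseries K}) :
  lev x (\sum_(i <- r) F i) = \sum_(i <- r) lev x (F i).
Proof. by rewrite /lev rmorph_sum horner_sum. Qed.
Lemma levCXn x c n : lev x (c%:P * 'X^n) = val c * x ^+ n.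
Proof.
have eC : map_poly (val : lseries K -> hseries K) c%:P = (val c)%:P by exact: map_polyC.
have eX : map_poly (val : lseries K -> hseries K) 'X^n = 'X^n by exact: map_polyXn.
by rewrite levM /lev eC eX hornerC hornerXn.
Qed.

(** Since [K((t))] is a field, dividing by the leading coefficient identifies integral with
    algebraic. *)
Lemma integral_polyP x :
  integral_over_laurent x <-> exists2 Q, Q != 0 & lev x Q = 0.
Proof.
split=> [[n [a [aL e]]]|[Q Q0 e]].
  have aex j : {b : lseries K | hcoef b = a j} by apply: cid; apply: lseries_ex.
  pose b j := sval (aex j); have bE j : hcoef (val (b j)) = a j := svalP (aex j).
  exists (1%:P * 'X^n + \sum_(j < n) (b j)%:P * 'X^j).
    apply/eqP => /(congr1 (fun Q : {poly lseries K} => Q`_n)) /eqP.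
    rewrite coefD coef_sum big1 => [|j _].
      by rewrite mul1r coefXn eqxx addr0 coef0 oner_eq0.
    by rewrite coefCM coefXn gtn_eqF ?mulr0.
  rewrite levD lev_sum levCXn mul1r; apply: hseries_eq => i.
  under eq_bigr => j _ do rewrite levCXn.
  rewrite hcoefD hcoef_sum -[RHS](e i) hpowE; congr (_ + _).
  by apply: eq_bigr => j _; rewrite hcoefM hpowE bE.
pose l := lead_coef Q; have l0 : l != 0 by rewrite lead_coef_eq0.
exists (size Q).-1, (fun j => hcoef (val (Q`_j / l))); split=> [j|k].
  exact: laurentP.
have sQ : size Q = (size Q).-1.+1 by rewrite prednK // lt0n size_poly_eq0.
have eQ : Q = \sum_(i < (size Q).-1.+1) Q`_i *: 'X^i by rewrite -sQ -poly_def coefK.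
have : lev x (\sum_(i < (size Q).-1.+1) Q`_i *: 'X^i) = 0 by rewrite -eQ.
rewrite lev_sum /= big_ord_recr /=.
under eq_bigr => j _ do rewrite -mul_polyC levCXn.
rewrite -mul_polyC levCXn -lead_coefE => /(congr1 (fun h => val l^-1 * h)).
rewrite mulr0 mulrDr mulr_sumr mulrA -[val _ * val (lead_coef Q)]rmorphM mulVf // rmorph1 mul1r.
move=> /(congr1 (fun h : hseries K => h k)); rewrite hcoefD hcoef0 hcoef_sum addrC => H.
rewrite -[RHS]H hpowE; congr (_ + _); apply: eq_bigr => j _.
rewrite [hpow x j]hpowE -[LHS]/((val (Q`_j / l) * x ^+ j) k).
by rewrite lvalM mulrA [val l^-1 * _]mulrC.
Qed.

End Integral.

Section Relations.
Variables (K : closedFieldType) (p : nat).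
Hypothesis pK : p \in [pchar K].
Let pp : prime p := pcharf_prime pK.
Implicit Types x : hseries K.

(** The [n + 1] remainders of the [X^(p^i)] modulo [Q] lie in a space of dimension [n = deg Q]. A
    dependence between them gives an additive multiple of [Q]. *)
Lemma integral_relation x : integral_over_laurent x ->
  exists n (v : 'rV[lseries K]_n.+1), v != 0 /\
    \sum_(i < n.+1) val (v 0 i) * x ^+ (p ^ i) = 0.
Proof.
move=> /integral_polyP[Q Q0 eQ]; set n := (size Q).-1.
have sQ : size Q = n.+1 by rewrite prednK // lt0n size_poly_eq0.
pose r i : {poly lseries K} := 'X^(p ^ i) %% Q.
have sr i : (size (r i) <= n)%N by rewrite -ltnS -sQ ltn_modp.
have [v v0 vM] := left_kernel (\matrix_(i < n.+1, j < n) (r i)`_j).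
exists n, v; split=> //.
have vr : \sum_(i < n.+1) (v 0 i)%:P * r i = 0.
  apply/polyP => j; rewrite coef_sum coef0; have [jn|nj] := ltnP j n.
    have := congr1 (fun w : 'rV_n => w 0 (Ordinal jn)) vM; rewrite !mxE => H.
    by rewrite -[RHS]H; apply: eq_bigr => i _; rewrite coefCM mxE.
  by rewrite big1 // => i _; rewrite coefCM nth_default ?mulr0 // (leq_trans (sr i)).
have : lev x (\sum_(i < n.+1) (v 0 i)%:P * 'X^(p ^ i)) = 0.
  have -> : \sum_(i < n.+1) (v 0 i)%:P * 'X^(p ^ i) =
      (\sum_(i < n.+1) (v 0 i)%:P * ('X^(p ^ i) %/ Q)) * Q.
    rewrite mulr_suml -[RHS]addr0 -[X in _ = _ + X]vr -big_split; apply: eq_bigr => i _.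
    by rewrite /= -mulrA -mulrDr -divp_eq.
  by rewrite levM eQ mulr0.
by rewrite lev_sum => H; rewrite -[RHS]H; apply: eq_bigr => i _; rewrite levCXn.
Qed.

Lemma relation_integral x n (v : 'rV[lseries K]_n.+1) : v != 0 ->
  \sum_(i < n.+1) val (v 0 i) * x ^+ (p ^ i) = 0 -> integral_over_laurent x.
Proof.
move=> v0 e; apply/integral_polyP.
exists (\sum_(i < n.+1) (v 0 i)%:P * 'X^(p ^ i)); last first.
  by rewrite lev_sum -[RHS]e; apply: eq_bigr => i _; rewrite levCXn.
have /rV0Pn[k vk] := v0.
apply: contraNneq vk => /(congr1 (fun Q : {poly lseries K} => Q`_(p ^ k))).
rewrite coef_sum coef0 (bigD1 k) //= coefCM coefXn eqxx mulr1 big1 ?addr0 => [->//|i ik].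
move: ik; rewrite -val_eqE eq_sym => /negPf ik.
by rewrite coefCM coefXn eqn_exp2l ?prime_gt1 // ik mulr0.
Qed.

Lemma integral_nice x : integral_over_laurent x -> nice p x.
Proof.
move=> /integral_relation[n [v [/rV0Pn[k vk] e]]].
pose A i : hseries K := if (i < n.+1)%N then val (v 0 (inord i)) else 0.
have exA : exists i, A i != 0.
  by exists k; rewrite /A ltn_ord inord_val; apply: contra_neq vk => h; exact: val_inj.
have ubA i : A i != 0 -> (i <= n)%N by rewrite /A ltnS; case: ifP; rewrite ?eqxx.
(* The relation is truncated at its last nonzero coefficient, as the induction on the degree needs a
   nonzero leading one. *)
case: (ex_maxnP exA ubA) => d Ad dmax.
apply: (@additive_relation_nice _ _ pK d A) => //.
  move=> i _; rewrite /A; case: ifP => _; last exact: isP0.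
  by exists 1%N => //; apply/lpredP; exact: valP.
have dn : (d.+1 <= n.+1)%N by rewrite ltnS ubA.
rewrite -[RHS]e (big_ord_widen _ (fun i => A i * x ^+ (p ^ i)) dn) big_mkcond /=.
apply: eq_bigr => i _; case: ifP => [_|/negbT]; first by rewrite /A ltn_ord inord_val.
rewrite -leqNgt => di; have [Ai0|/dmax] := eqVneq (A i) 0; last by rewrite leqNgt di.
by move: Ai0; rewrite /A ltn_ord inord_val => ->; rewrite mul0r.
Qed.

(** Collecting over [n] the coordinates of the fractional parts of [x^(p^k)] gives Laurent series
    [f k j], with [x^(p^k)] the sum of the [f k j * beta j]. The first [d + 1] powers thus lie in
    the [K((t))]-span of [d] functions. *)
Lemma good_integral x : good p x -> integral_over_laurent x.
Proof.
move=> gx; have [d [g gP]] := fdim_generators gx.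
pose beta j := fracfam p x (g j).
have low k : {c : rat | forall i, (x ^+ (p ^ k)) i != 0 -> c <= i}.
  by apply: cid; exact: hahn_bounded (hseriesP (x := x ^+ (p ^ k))).
(* Coordinates need not be unique; imposing 0 where the fractional part vanishes for reasons of
   valuation keeps [f k j] bounded below. *)
have cex k n : {c : 'I_d -> K | (forall i, fracfam p x (n, k) i = \sum_j c j * beta j i) /\
    (n%:~R + 1 <= sval (low k) -> forall j, c j = 0)}.
  apply: cid; have [h|h] := boolP (n%:~R + 1 <= sval (low k)); last first.
    by have [c cP] := gP (n, k); exists c; split=> //; rewrite (negPf h).
  exists (fun _ => 0); split=> // i; rewrite big1 => [|j _]; last by rewrite mul0r.
  rewrite (fracfamE pK) /yser /=; case: ifP => // /andP[i0 i1].
  apply: contrapT => /eqP /(svalP (low k)); apply/negP; rewrite -ltNge.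
  by apply: lt_le_trans h; rewrite ltrD2l.
pose f k j : rat -> K := fun i =>
  if i \is a Num.int then sval (cex k (Num.floor i)) j else 0.
have f_int k j (n : int) : f k j n%:~R = sval (cex k n) j.
  by rewrite /f intr_int intrKfloor.
have fL k j : laurent (f k j).
  have f1 : puis 1 (f k j).
    by move=> i; rewrite /f mul1r; case: ifP => //; rewrite eqxx.
  split=> [|i /f1]; last by rewrite mul1r.
  apply: (@hahn_puis _ 1 (sval (low k) - 1)) => // i.
  rewrite /f; case: ifP; rewrite ?eqxx // => /intrP[n ->]; rewrite intrKfloor => nz.
  rewrite lerBlDr; apply: contraNT nz; rewrite -ltNge => /ltW h.
  by rewrite ((svalP (cex k n)).2 h j).
have fex k j : {b : lseries K | hcoef b = f k j} by apply: cid; apply: lseries_ex.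
have [v v0 vM] := left_kernel (\matrix_(k < d.+1, j < d) sval (fex k j)).
apply: (relation_integral v0); apply: hseries_eq => q; rewrite hcoef_sum hcoef0.
pose n := Num.floor q; pose i := q - n%:~R.
have eq : q = n%:~R + i by rewrite addrC subrK.
have [i0 i1] : 0 <= i /\ i < 1.
  have /andP[h0 h1] := floor_itv q; split; first by rewrite subr_ge0.
  by rewrite ltrBlDr; move: h1; rewrite rmorphD /= addrC.
(* A Laurent factor [V] has integer exponents, so it moves [n] and leaves the fractional part [i]
   alone. The value [beta j i] therefore factors out of the product. *)
have termE (k : 'I_d.+1) : (val (v 0 k) * x ^+ (p ^ k)) q =
    \sum_(j < d) (val (v 0 k) * val (sval (fex k j))) n%:~R * beta j i.
  set V := val (v 0 k); set h := x ^+ _.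
  have sj (j : 'I_d) : {s : seq rat | forall m, V m != 0 ->
      (val (sval (fex k j))) (n%:~R - m) != 0 -> m \in s}.
    apply: cid; have [s [_ sP]] := hmul_fin n%:~R (hseriesP (x := V))
      (hseriesP (x := val (sval (fex k j)))); by exists s.
  have [s0 [_ s0P]] := hmul_fin q (hseriesP (x := V)) (hseriesP (x := h)).
  pose s := undup (s0 ++ flatten [seq sval (sj j) | j <- enum 'I_d]).
  have us : uniq s by exact: undup_uniq.
  rewrite hcoefM (hmulE us); last first.
    by move=> m Vm hm; rewrite mem_undup mem_cat s0P.
  transitivity (\sum_(j < d) \sum_(m <- s)
      V m * val (sval (fex k j)) (n%:~R - m) * beta j i); last first.
    apply: eq_bigr => j _; rewrite hcoefM (hmulE us) ?mulr_suml // => m Vm fm.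
    rewrite mem_undup mem_cat; apply/orP; right; apply/flattenP.
    exists (sval (sj j)); last exact: (svalP (sj j)).
    by apply/mapP; exists j => //; rewrite mem_enum.
  rewrite exchange_big; apply: eq_bigr => m _ /=.
  have [->|Vm] := eqVneq (V m) 0.
    by rewrite mul0r big1 // => j _; rewrite !mul0r.
  have /intrP[m' em] : m \is a Num.int.
    by have := lpredP _ (valP (v 0 k)) m Vm; rewrite mul1r.
  have -> : h (q - m) = fracfam p x (n - m', nat_of_ord k) i.
    rewrite (fracfamE pK) /yser /= i0 i1 /=; congr (hcoef h _).
    by rewrite em eq rmorphB /=; ring.
  rewrite ((svalP (cex k (n - m'))).1 i) mulr_sumr; apply: eq_bigr => j _.
  by rewrite mulrA (svalP (fex k j)) em -rmorphB f_int.
under eq_bigr => k _ do rewrite termE.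
rewrite exchange_big big1 //= => j _; rewrite -mulr_suml.
have -> : \sum_(k < d.+1) (val (v 0 k) * val (sval (fex k j))) n%:~R =
    val ((v *m \matrix_(k < d.+1, j < d) sval (fex k j)) 0 j) n%:~R.
  rewrite mxE rmorph_sum hcoef_sum; apply: eq_bigr => k _.
  by rewrite rmorphM mxE.
by rewrite vM mxE rmorph0 hcoef0 mul0r.
Qed.

End Relations.

Theorem theorem10p6 (p : nat) (K : closedFieldType) (x : rat -> K) :
  prime p -> p \in [pchar K] -> hahn x ->
  (integral_over_laurent x <->
     ((forall n : int, quasi_automatic p (yser x n)) /\ fin_span (yser x))).
Proof.
move=> _ pK hx; rewrite -[x]/(hcoef (mkH hx)); split=> [/(integral_nice pK) nx|[qx sx]].
  by split=> [n|]; [exact: nice_quasi | exact: good_fin_span nx.1].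
apply: (good_integral pK); apply: (good_of_yser pK) => // n.
exact: quasi_good.
Qed.
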